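(* Let $R$ be a root system in $\mathbb{R}^n$ with Weyl group $W$ and let $k:R\to[0,\infty)$ be $W$-invariant. For $x\in\mathbb{R}^n$ let $(X^{(k,R,x)}_t)_{t\ge0}$ denote the Dunkl process associated with $(R,k)$ started at $x$. Then for every $\theta\in O(\mathbb{R}^n)$ (the orthogonal group of $\mathbb{R}^n$) and every $x\in\mathbb{R}^n$, $$(\theta X_t^{(k,R,x)})_{t\ge0}\overset{(d)}{=}(X_t^{(k_\theta,\theta R,\theta x)})_{t\ge0},$$ where $\theta R=\{\theta\alpha:\alpha\in R\}$ and $k_\theta:\theta R\to[0,\infty)$, $k_\theta(\alpha)=k({}^t\theta\,\alpha)$, with ${}^t\theta$ the transpose of $\theta$.
   Context: A root system is a finite set $R\subset\mathbb{R}^n\setminus\{0\}$ with $R\cap\mathbb{R}\alpha=\{\pm\alpha\}$ and $\sigma_\alpha(R)=R$ for all $\alpha\in R$, where $\sigma_\alpha$ is the orthogonal reflection in the hyperplane $H_\alpha=\alpha^\perp$. Roots are normalized by $\alpha\cdot\alpha=2$, so $\sigma_\alpha(x)=x-(\alpha\cdot x)\alpha$. The (finite) Weyl group $W$ is generated by $\{\sigma_\alpha:\alpha\in R\}$. A positive subsystem is $R_+=\{\alpha\in R:\alpha\cdot\beta>0\}$ for some $\beta\notin\bigcup_{\alpha\in R}H_\alpha$. $k:R\to[0,\infty)$ is $W$-invariant if $k(w\alpha)=k(\alpha)$ for all $w\in W$, $\alpha\in R$. Dunkl process associated with $(R,k)$: the càdlàg Feller Markov process on $\mathbb{R}^n$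 with transition densities (independent of the choice of $R_+$) $$p_t(x,y)=\frac{1}{c_kt^{\gamma+n/2}}\exp\Big(-\frac{|x|^2+|y|^2}{2t}\Big)D_k\Big(\frac{x}{\sqrt t},\frac{y}{\sqrt t}\Big)\prod_{\alpha\in R_+}|\alpha\cdot y|^{2k(\alpha)},$$ $\gamma=\sum_{\alpha\in R_+}k(\alpha)$, $c_k=\int_{\mathbb{R}^n}e^{-|x|^2/2}\prod_{\alpha\in R_+}|\alpha\cdot x|^{2k(\alpha)}dx$, where $D_k$ is the Dunkl kernel: $D_k(\cdot,y)$ is the unique real-analytic $f$ with $f(0)=1$ and $T_\xi f=(\xi\cdot y)f$ for all $\xi\in\mathbb{R}^n$, with $T_\xi f(x)=\partial_\xi f(x)+\sum_{\alpha\in R_+}k(\alpha)(\alpha\cdot\xi)\frac{f(x)-f(\sigma_\alpha x)}{\alpha\cdot x}$. Its extended generator is, for $u\in\mathbf{C}^2_K(\mathbb{R}^n)$ (compactly supported $C^2$ functions), $$\mathcal{L}_ku(x)=\frac12\Delta u(x)+\sum_{\alpha\in R_+}k(\alpha)\Big[\frac{\nabla u(x)\cdot\alpha}{x\cdot\alpha}-\frac{u(x)-u(\sigma_\alpha x)}{(x\cdot\alpha)^2}\Big].$$ (Known characterization: a càdlàg process $X$ on $\mathbb{R}^n$ with $\|X\|$ continuous is this process iff $f(X_t)-f(X_0)-\int_0^t\mathcal{L}_kf(X_s)ds$ is a martingale for all $f\in\mathbf{C}_K^2(\mathbb{R}^n)$.) $\overset{(d)}{=}$ denotes equality in law of processes.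 *)

(* Defs.v *)
From HB Require Import structures.
From mathcomp Require Import all_boot all_order all_algebra finmap.
From mathcomp Require Import all_classical all_reals all_analysis.

Set Implicit Arguments.
Unset Strict Implicit.
Unset Printing Implicit Defensive.

Import Order.TTheory GRing.Theory Num.Theory.
Import numFieldNormedType.Exports.

Local Open Scope classical_set_scope.
Local Open Scope ring_scope.

(* R^n is 'cV[R]_n, so that a matrix theta acts as theta *m x. Its
   sigma-algebra is the one generated by the coordinates, i.e. the Borel one. *)
Section measurable_cV.
Context {R : realType} (n : nat).

Let coord (i : 'I_n) (v : 'cV[R]_n) : measurableTypeR R := v i 0.

Let cV_set0 : g_sigma_preimage coord set0.
Proof. exact: sigma_algebra0. Qed.

Let cV_setC A : g_sigma_preimage coord A -> g_sigma_preimage coord (~` A).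
Proof. exact: sigma_algebraC. Qed.

Let cV_bigcup (F : _^nat) : (forall i, g_sigma_preimage coord (F i)) ->
  g_sigma_preimage coord (\bigcup_i (F i)).
Proof. exact: sigma_algebra_bigcup. Qed.

HB.instance Definition _ := @isMeasurable.Build default_measure_display
  'cV[R]_n (g_sigma_preimage coord) cV_set0 cV_setC cV_bigcup.

Lemma measurable_coord (i : 'I_n) :
  measurable_fun setT (fun v : 'cV[R]_n => v i 0 : measurableTypeR R).
Proof.
move=> _ Y mY; rewrite setTI; apply: sub_sigma_algebra => /=.
rewrite -bigcup_seq/=; exists i => /=; first by rewrite mem_index_enum.
by exists Y => //; rewrite setTI.
Qed.

Lemma measurable_fun_coord d (T : measurableType d) (f : T -> 'cV[R]_n) :
  (forall i, measurable_fun setT (fun t => f t i 0 : measurableTypeR R)) ->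
  measurable_fun setT f.
Proof.
move=> mf; apply: (measurability (\big[setU/set0]_(i < n)
  preimage_set_system setT (coord i) measurable)) => //.
move=> _ [A + <-].
rewrite -bigcup_seq/= => -[i _ [B mB <-]].
by have := mf i measurableT B mB; rewrite !setTI.
Qed.

End measurable_cV.

Section lebesgue_cV.
Context {R : realType}.

Section cons.
Context (n : nat) (mu : {sigma_finite_measure set 'cV[R]_n -> \bar R}).

Definition cV_cons (p : measurableTypeR R * 'cV[R]_n) : 'cV[R]_n.+1 :=
  col_mx (const_mx p.1 : 'cV[R]_1) p.2.

Lemma measurable_cV_cons : measurable_fun setT cV_cons.
Proof.
apply: measurable_fun_coord => i.
have [j ->|j ->] := split_ordP (i : 'I_(1 + n)).
- apply: (eq_measurable_fun fst) => [p _|//].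
  by apply/esym; apply: etrans (col_mxEu _ _ _ _) _; rewrite mxE.
- apply: (eq_measurable_fun
    ((fun v : 'cV[R]_n => v j 0 : measurableTypeR R) \o snd)) => [p _|].
    by apply/esym; exact: col_mxEd.
  by apply: measurableT_comp => //; exact: measurable_coord.
Qed.

Definition lebesgue_cV_cons : set 'cV[R]_n.+1 -> \bar R :=
  pushforward (lebesgue_measure \x mu)%E cV_cons.

Let lebesgue_cV_cons0 : lebesgue_cV_cons set0 = 0%E.
Proof. by rewrite /lebesgue_cV_cons /pushforward preimage_set0 measure0. Qed.

Let lebesgue_cV_cons_ge0 A : (0 <= lebesgue_cV_cons A)%E.
Proof. exact: (measure_ge0 (lebesgue_measure \x mu)%E). Qed.

Let lebesgue_cV_cons_sigma_additive : semi_sigma_additive lebesgue_cV_cons.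
Proof.
move=> F mF tF mUF; rewrite /lebesgue_cV_cons /pushforward preimage_bigcup.
have mpre (A : set 'cV[R]_n.+1) : measurable A -> measurable (cV_cons @^-1` A).
  by move=> mA; rewrite -[X in measurable X]setTI; exact: measurable_cV_cons.
apply: measure_semi_sigma_additive.
- by move=> m; exact: mpre.
- apply/trivIsetP => /= i j _ _ ij; rewrite -preimage_setI.
  by move/trivIsetP : tF => /(_ _ _ _ _ ij) ->//; rewrite preimage_set0.
- by rewrite -preimage_bigcup; exact: mpre.
Qed.

HB.instance Definition _ := isMeasure.Build _ _ _ lebesgue_cV_cons
  lebesgue_cV_cons0 lebesgue_cV_cons_ge0 lebesgue_cV_cons_sigma_additive.

Let lebesgue_cV_cons_sigma_finite : sigma_finite setT lebesgue_cV_cons.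
Proof.
pose uncons (v : 'cV[R]_n.+1) : measurableTypeR R * 'cV[R]_n :=
  ((v : 'cV[R]_(1 + n)) (lshift n 0) 0, dsubmx (v : 'cV[R]_(1 + n))).
have consK : cancel cV_cons uncons.
  by case=> a v; rewrite /uncons /cV_cons col_mxEu mxE /= col_mxKd.
have muncons : measurable_fun setT uncons.
  apply: measurable_fun_pair; first exact: measurable_coord.
  apply: measurable_fun_coord => i.
  apply: (eq_measurable_fun
    (fun v : 'cV[R]_n.+1 => v (rshift 1 i) 0 : measurableTypeR R)).
    by move=> v _; rewrite mxE.
  exact: measurable_coord.
have /sigma_finiteP[F [TF ndF Foo]] := sigma_finiteT (@lebesgue_measure R).
have /sigma_finiteP[G [TG ndG Goo]] := sigma_finiteT mu.
exists (fun m => uncons @^-1` (F m `*` G m)).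
  apply/esym; rewrite -subTset => v _.
  have [m _ Fm] : (\bigcup_i F i) (uncons v).1 by rewrite -TF.
  have [l _ Gl] : (\bigcup_i G i) (uncons v).2 by rewrite -TG.
  exists (maxn m l) => //; split.
    by move: Fm; exact/subsetPset/ndF/leq_maxl.
  by move: Gl; exact/subsetPset/ndG/leq_maxr.
move=> m; have [mF Fm] := Foo m; have [mG Gm] := Goo m; split.
  by rewrite -[X in measurable X]setTI; apply: muncons => //; exact: measurableX.
rewrite /lebesgue_cV_cons /pushforward -comp_preimage.
rewrite (_ : uncons \o cV_cons = id); last first.
  by apply/funext => p /=; rewrite consK.
by rewrite preimage_id product_measure1E// lte_mul_pinfty// ge0_fin_numE.
Qed.

HB.instance Definition _ := Measure_isSigmaFinite.Build _ _ _ lebesgue_cV_cons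
  lebesgue_cV_cons_sigma_finite.

End cons.

(* Lebesgue measure on R^n as the n-fold product of [lebesgue_measure]. *)
Fixpoint lebesgue_cV (n : nat) : {sigma_finite_measure set 'cV[R]_n -> \bar R} :=
  if n is m.+1 then lebesgue_cV_cons (lebesgue_cV m) else \d_(0 : 'cV[R]_0).

End lebesgue_cV.

Section root_systems.
Context {R : realType} {n : nat}.
Implicit Types (Phi Pp : {fset 'cV[R]_n}) (k : 'cV[R]_n -> R).
Implicit Types (a b x y xi : 'cV[R]_n).

Definition dot x y : R := \sum_i x i 0 * y i 0.

Definition orthogonal_mx (theta : 'M[R]_n) := theta^T *m theta = 1%:M.

(* The orthogonal reflection in the hyperplane a^\perp when dot a a = 2. *)
Definition reflection a x : 'cV[R]_n := x - dot a x *: a.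

Definition root_system Phi :=
  [/\ 0 \notin Phi,
      forall a, a \in Phi ->
        [set` Phi] `&` [set c *: a | c in [set: R]] = [set a; - a],
      forall a, a \in Phi -> reflection a @` [set` Phi] = [set` Phi]
    & forall a, a \in Phi -> dot a a = 2].

(* The group generated by the reflections: no closure under inverses is needed,
   since reflections are involutions. *)
Inductive weyl_group Phi : ('cV[R]_n -> 'cV[R]_n) -> Prop :=
| weyl_id : weyl_group Phi id
| weyl_reflection a w :
    a \in Phi -> weyl_group Phi w -> weyl_group Phi (reflection a \o w).

(* Only the values of k on Phi matter. *)
Definition multiplicity_function Phi k :=
  (forall a, a \in Phi -> 0 <= k a) /\
  (forall w a, weyl_group Phi w -> a \in Phi -> k (w a) = k a).

Definition positive_subsystem Phi Pp :=
  exists2 b, (forall a, a \in Phi -> dot a b != 0) &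
             Pp = [fset a in Phi | 0 < dot a b]%fset.

(* In a neighbourhood of every point, f is the sum of an absolutely convergent
   power series; the exponents (multi-indices) are summed over cubes [0, N[^n. *)
Definition monomial (m : {ffun 'I_n -> nat}) x : R := \prod_i x i 0 ^+ m i.

Definition multi_index N (m : {ffun 'I_n -> 'I_N}) : {ffun 'I_n -> nat} :=
  [ffun i => nat_of_ord (m i)].

Definition real_analytic (f : 'cV[R]_n -> R) :=
  forall x, exists2 r : R, 0 < r & exists c : {ffun 'I_n -> nat} -> R,
    forall h : 'cV[R]_n, (forall i, `|h i 0| < r) ->
      cvgn (fun N => \sum_(m : {ffun 'I_n -> 'I_N})
                       `|c (multi_index m) * monomial (multi_index m) h|) /\
      (\sum_(m : {ffun 'I_n -> 'I_N})
          c (multi_index m) * monomial (multi_index m) h) @[N --> \oo]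
        --> f (x + h).

(* On the hyperplane a^\perp, the difference quotient stands for its limit, the
   derivative along a. *)
Definition difference_quotient a (f : 'cV[R]_n -> R) x : R :=
  if dot a x == 0 then 'D_a f x else (f x - f (reflection a x)) / dot a x.

Definition dunkl_operator Pp k xi (f : 'cV[R]_n -> R) x : R :=
  'D_xi f x + \sum_(a <- Pp) k a * dot a xi * difference_quotient a f x.

Definition is_dunkl_kernel Pp k y (f : 'cV[R]_n -> R) :=
  [/\ real_analytic f, f 0 = 1 &
      forall xi x, dunkl_operator Pp k xi f x = dot xi y * f x].

(* The unique f such that is_dunkl_kernel Pp k y f, taken at x. *)
Definition dunkl_kernel Pp k x y : R :=
  xget (fun=> 0) [set f | is_dunkl_kernel Pp k y f] x.

Definition dunkl_weight Pp k x : R :=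
  \prod_(a <- Pp) `|dot a x| `^ (2 * k a).

Definition dunkl_gamma Pp k : R := \sum_(a <- Pp) k a.

Definition dunkl_constant Pp k : R :=
  \int[lebesgue_cV n]_x (expR (- (dot x x / 2)) * dunkl_weight Pp k x).

Definition dunkl_density Pp k (t : R) x y : R :=
  (dunkl_constant Pp k * t `^ (dunkl_gamma Pp k + n%:R / 2))^-1 *
  expR (- ((dot x x + dot y y) / (2 * t))) *
  dunkl_kernel Pp k ((Num.sqrt t)^-1 *: x) ((Num.sqrt t)^-1 *: y) *
  dunkl_weight Pp k y.

End root_systems.

Section processes.
Context {R : realType} {n : nat}.

Definition vanishing_at_infinity (f : 'cV[R]_n -> R) :=
  forall e, 0 < e ->
    exists2 K, compact K & forall x, ~ K x -> `|f x| < e.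

Definition C0 (f : 'cV[R]_n -> R) := continuous f /\ vanishing_at_infinity f.

(* The operators f |-> (x |-> \int[Q t x]_y f y), for t > 0, together with the
   identity at time 0, form a Feller semigroup. *)
Definition feller_semigroup (Q : R -> R.-pker 'cV[R]_n ~> 'cV[R]_n) :=
  [/\ forall s t x (B : set 'cV[R]_n), 0 < s -> 0 < t -> measurable B ->
        Q (s + t) x B = (\int[Q s x]_y Q t y B)%E,
      forall t f, 0 < t -> C0 f -> C0 (fun x => \int[Q t x]_y f y)
    & forall f, C0 f -> forall e, 0 < e ->
        \forall t \near 0^'+, forall x, `|(\int[Q t x]_y f y) - f x| < e].

Context d (T : measurableType d) (P : probability T R).
Implicit Type X : R -> T -> 'cV[R]_n.

(* A process is indexed by R, but only its values at times t >= 0 matter. *)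
Definition natural_filtration X (t : R) : set (set T) :=
  <<s [set A | exists s (B : set 'cV[R]_n),
         [/\ 0 <= s <= t, measurable B & A = X s @^-1` B]] >>.

Definition cadlag (g : R -> 'cV[R]_n) :=
  (forall t, 0 <= t -> g s @[s --> t^'+] --> g t) /\
  (forall t, 0 < t -> cvg (g s @[s --> t^'-])).

(* The second condition says that, with respect to the natural filtration (F_s),
   P(X_(s+t) \in B | F_s) = Q t (X_s) B almost surely. *)
Definition markov_process (Q : R -> R.-pker 'cV[R]_n ~> 'cV[R]_n) X :=
  (forall t, 0 <= t -> measurable_fun setT (X t)) /\
  (forall s t A (B : set 'cV[R]_n), 0 <= s -> 0 < t ->
     natural_filtration X s A -> measurable B ->
     P (A `&` X (s + t) @^-1` B) = (\int[P]_(w in A) Q t (X s w) B)%E).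

Definition dunkl_process (k : 'cV[R]_n -> R) (Phi : {fset 'cV[R]_n})
    (x : 'cV[R]_n) X :=
  exists Pp (Q : R -> R.-pker 'cV[R]_n ~> 'cV[R]_n),
    [/\ positive_subsystem Phi Pp,
        forall t y (B : set 'cV[R]_n), 0 < t -> measurable B ->
          Q t y B = (\int[lebesgue_cV n]_(z in B) (dunkl_density Pp k t y z)%:E)%E,
        feller_semigroup Q,
        markov_process Q X &
        (forall w, cadlag (X ^~ w)) /\ P (X 0 @^-1` [set x]) = 1%E].

End processes.

Section laws.
Context {R : realType} {n : nat}.

(* The cylinder sigma-algebra on paths, restricted to times t >= 0. *)
Definition cylinder : set (set (R -> 'cV[R]_n)) :=
  <<s [set A | exists t (B : set 'cV[R]_n),
         [/\ 0 <= t, measurable B & A = [set g | B (g t)]]] >>.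

Definition equal_in_law d (T : measurableType d) (P : probability T R)
    (X : R -> T -> 'cV[R]_n) d' (T' : measurableType d')
    (P' : probability T' R) (Y : R -> T' -> 'cV[R]_n) :=
  forall A, cylinder A ->
    P [set w | A (X ^~ w)] = P' [set w | A (Y ^~ w)].

End laws.

(* Main.v *)
(* The densities p_t(x, y) of (theta R, k_theta) at (theta x, theta y) and of
   (R, k) at (x, y) agree: the Gaussian factor, the weight and gamma are visibly
   invariant, c_k is so because theta preserves Lebesgue measure, and D_k is so
   by uniqueness, since composition with theta intertwines the Dunkl operators.
   Hence theta X is a Markov process with the kernels of Y and the same initial
   law, and the two processes have the same finite-dimensional laws.

   Uniqueness of D_k(., y) is a maximum principle. On the diagonal xi = x the
   Dunkl system reads
     D_x f(x) + \sum_a k(a) (f(x) - f(sigma_a x)) = (x . y) f(x),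
   and the difference of two solutions cannot have a positive maximum on a ball
   after multiplication by exp(- C |x|) with C > |y|. This uses only continuity
   and differentiability, so it is not necessary to know that real analyticity
   is preserved by theta.

   Existence of D_k(., y) for almost every y comes from the process itself:
   where no kernel exists the density is 0 by convention, but p_1(0, .) has
   mass 1. *)
Require Import Defs.
From mathcomp Require Import all_boot all_order all_algebra finmap.
From mathcomp Require Import all_classical all_reals all_analysis.
From mathcomp Require Import measurable_realfun ring lra.

Set Implicit Arguments.
Unset Strict Implicit.
Unset Printing Implicit Defensive.

Import Order.TTheory GRing.Theory Num.Theory.
Import numFieldNormedType.Exports.

Local Open Scope classical_set_scope.
Local Open Scope ring_scope.

(** * The Euclidean inner product *)

Section dot.
Context {R : realType} {n : nat}.
Implicit Types (x y z a : 'cV[R]_n).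

Lemma dotE x y : dot x y = (x^T *m y) 0 0.
Proof. by rewrite mxE; apply: eq_bigr => i _; rewrite mxE. Qed.

Lemma dotC x y : dot x y = dot y x.
Proof. by apply: eq_bigr => i _; rewrite mulrC. Qed.

Lemma dotDl x y z : dot (x + y) z = dot x z + dot y z.
Proof. by rewrite !dotE linearD /= mulmxDl mxE. Qed.

Lemma dotZl c x y : dot (c *: x) y = c * dot x y.
Proof. by rewrite !dotE linearZ /= -scalemxAl mxE. Qed.

Lemma dotNl x y : dot (- x) y = - dot x y.
Proof. by rewrite -scaleN1r dotZl mulN1r. Qed.

Lemma dotDr x y z : dot z (x + y) = dot z x + dot z y.
Proof. by rewrite dotC dotDl !(dotC _ z). Qed.

Lemma dotZr c x y : dot y (c *: x) = c * dot y x.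
Proof. by rewrite dotC dotZl dotC. Qed.

Lemma dotNr x y : dot y (- x) = - dot y x.
Proof. by rewrite dotC dotNl dotC. Qed.

Lemma dotNN x y : dot (- x) (- y) = dot x y.
Proof. by rewrite dotNl dotNr opprK. Qed.

Lemma dot0l x : dot 0 x = 0.
Proof. by rewrite -(scale0r 0) dotZl mul0r. Qed.

Lemma dot_ge0 x : 0 <= dot x x.
Proof. by apply: sumr_ge0 => i _; rewrite -expr2 sqr_ge0. Qed.

Lemma dot_orthogonal (M : 'M[R]_n) x y :
  orthogonal_mx M -> dot (M *m x) (M *m y) = dot x y.
Proof.
by move=> oM; rewrite !dotE trmx_mul -mulmxA (mulmxA M^T) oM mul1mx.
Qed.

Lemma dot_eq0 x : (dot x x == 0) = (x == 0).
Proof.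
apply/eqP/eqP => [|->]; last exact: dot0l.
move=> /eqP; rewrite psumr_eq0 => [/allP H|i _]; last by rewrite -expr2 sqr_ge0.
apply/colP => i; rewrite mxE; apply/eqP.
by have := H i (mem_index_enum i); rewrite mulf_eq0 orbb.
Qed.

End dot.

(** * Lebesgue measure on R^n *)

Section lebesgue_invariance.
Context {R : realType}.
Local Notation leb := (@lebesgue_cV R).

Lemma measurable_preimage d1 d2 (T1 : measurableType d1) (T2 : measurableType d2)
    (f : T1 -> T2) (B : set T2) :
  measurable_fun setT f -> measurable B -> measurable (f @^-1` B).
Proof. by move=> mf mB; rewrite -[X in measurable X]setTI; exact: mf. Qed.

Lemma measurable_mulmx n (M : 'M[R]_n) :
  measurable_fun setT (fun v : 'cV[R]_n => M *m v).
Proof.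
apply: measurable_fun_coord => i.
apply: (eq_measurable_fun
  (fun v : 'cV[R]_n => \sum_j M i j * v j 0 : measurableTypeR R)).
  by move=> v _; rewrite mxE.
apply: measurable_sum => j; apply: measurable_funM => //.
exact: measurable_coord.
Qed.

Lemma measurable_cVD d (T : measurableType d) n (f g : T -> 'cV[R]_n) :
  measurable_fun setT f -> measurable_fun setT g ->
  measurable_fun setT (fun t => f t + g t).
Proof.
move=> mf mg; apply: measurable_fun_coord => i.
apply: (eq_measurable_fun
  (fun t => f t i 0 + g t i 0 : measurableTypeR R)).
  by move=> t _; rewrite mxE.
apply: measurable_funD.
  exact: (measurableT_comp (measurable_coord i) mf).
exact: (measurableT_comp (measurable_coord i) mg).
Qed.

Lemma cV_consEu n (p : measurableTypeR R * 'cV[R]_n) (j : 'I_1) :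
  cV_cons p (lshift n j : 'I_(1 + n)) 0 = p.1.
Proof. by apply: etrans (col_mxEu _ _ _ _) _; rewrite mxE. Qed.

Lemma cV_consEd n (p : measurableTypeR R * 'cV[R]_n) (j : 'I_n) :
  cV_cons p (rshift 1 j : 'I_(1 + n)) 0 = p.2 j 0.
Proof. exact: col_mxEd. Qed.

(** The translated measure gives half-open intervals their length, which determines Lebesgue
    measure. *)
Lemma lebesgue_measureD (a : R) (A : set (measurableTypeR R)) :
  measurable A -> lebesgue_measure ((fun t => t + a) @^-1` A) = lebesgue_measure A.
Proof.
pose tr : measurableTypeR R -> measurableTypeR R := fun t => t + a.
have ma : measurable_fun setT tr by exact: measurable_funD.
move=> mA; rewrite -[LHS]/(pushforward lebesgue_measure tr A).
apply/esym/lebesgue_measure_unique => //= _ [[x y] _ <-].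
rewrite /pushforward.
have -> : tr @^-1` `]x, y] = `]x - a, y - a]%classic.
  by apply/seteqP; split => t /=; rewrite !in_itv /= ltrBlDr lerBrDr.
rewrite !lebesgue_measure_itv /= !lte_fin ltrD2r; case: ifP => // _.
by rewrite -!EFinB; congr (_%:E); ring.
Qed.

(** Induction on the dimension: translation acts on each factor of the product separately, so the
    translated measure has the right value on rectangles. *)
Lemma lebesgue_cVD n (v : 'cV[R]_n) (A : set 'cV[R]_n) :
  measurable A -> leb n ((fun x => x + v) @^-1` A) = leb n A.
Proof.
elim: n => [|n IH] in v A *; move=> mA.
  by congr (leb 0 _); apply/seteqP; split=> x; rewrite /= [_ + v]flatmx0 [x]flatmx0.
have [a [u ->]] : exists a u, v = cV_cons (a, u).
  exists ((v : 'cV[R]_(1 + n)) (lshift n 0) 0), (dsubmx (v : 'cV[R]_(1 + n))).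
  rewrite /cV_cons /= (_ : const_mx _ = usubmx (v : 'cV[R]_(1 + n))).
    by rewrite vsubmxK.
  by apply/colP => i; rewrite !mxE ord1.
rewrite /= /lebesgue_cV_cons /pushforward.
pose tr (p : measurableTypeR R * 'cV[R]_n) : measurableTypeR R * 'cV[R]_n :=
  (p.1 + a, p.2 + u).
have mtr : measurable_fun setT tr.
  apply: measurable_fun_pair; first by apply: measurable_funD.
  by apply: measurable_cVD.
have -> : @cV_cons R n @^-1` ((fun x => x + cV_cons (a, u)) @^-1` A) =
    tr @^-1` (@cV_cons R n @^-1` A).
  apply/funext => -[b w]; congr (A _).
  apply: (etrans (@add_col_mx _ 1 n 1 _ _ _ _)).
  rewrite (_ : const_mx b + _ = const_mx (b + a))//.
  by apply/matrixP => i j; rewrite !mxE.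
rewrite -[LHS]/(pushforward (lebesgue_measure \x leb n)%E tr _).
apply/esym/product_measure_unique => //; last first.
  by apply: measurable_preimage => //; exact: measurable_cV_cons.
  move=> B C mB mC; rewrite /= /pushforward.
  have -> : tr @^-1` (B `*` C) =
      ((fun t => t + a) @^-1` B) `*` ((fun x => x + u) @^-1` C) by [].
  rewrite product_measure1E.
  - by congr (_ * _)%E; [exact: lebesgue_measureD|exact: IH].
  - by apply: measurable_preimage => //; exact: measurable_funD.
  - by apply: measurable_preimage => //; exact: measurable_cVD.
Qed.

Lemma lebesgue_cV_gt0 n : (0 < leb n setT)%E.
Proof.
elim: n => [|n IH] /=; first by rewrite diracT lte01.
rewrite /lebesgue_cV_cons /pushforward preimage_setT -setXTT product_measure1E//.
rewrite mule_gt0//.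
have := @lebesgue_measure_itv R `]-oo, +oo[; rewrite set_itvE => H.
by rewrite [ltRHS]H ltry.
Qed.

Lemma measurable_cube n (m : R) :
  measurable [set x : 'cV[R]_n | forall i, (`|x i 0| <= m)%R].
Proof.
have -> : [set x : 'cV[R]_n | forall i, (`|x i 0| <= m)%R] =
    \bigcap_(i in [set: 'I_n]) (fun x : 'cV[R]_n => x i 0) @^-1` `[- m, m].
  apply/seteqP; split => x /= H i; first by move=> _ /=; rewrite in_itv /= -ler_norml.
  by have := H i I; rewrite /= in_itv /= -ler_norml.
apply: fin_bigcap_measurable => // i _.
by apply: measurable_preimage => //; exact: measurable_coord.
Qed.

Lemma lebesgue_cV_cube n (m : R) : 0 <= m ->
  (leb n [set x | forall i, (`|x i 0| <= m)%R] < +oo)%E.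
Proof.
move=> m0; elim: n => [|n IH].
  by rewrite -[leb 0 _]/(dirac _ _) diracE ltry.
rewrite /= /lebesgue_cV_cons /pushforward.
have -> : @cV_cons R n @^-1` [set x : 'cV[R]_n.+1 | forall i, `|x i 0| <= m] =
    (`[- m, m]%classic : set (measurableTypeR R)) `*`
    [set x : 'cV[R]_n | forall i, `|x i 0| <= m].
  apply/seteqP; split => [[b w]|[b w] [/= bm wm] i] /=.
    move=> H; split => [|i].
      have := H (lshift n 0 : 'I_(1 + n)).
      by rewrite cV_consEu in_itv /= -ler_norml.
    by have := H (rshift 1 i : 'I_(1 + n)); rewrite cV_consEd.
  have [j ->|j ->] := split_ordP (i : 'I_(1 + n)).
    by move: bm; rewrite cV_consEu in_itv /= -ler_norml.
  by rewrite cV_consEd.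
rewrite product_measure1E//; last exact: measurable_cube.
rewrite lte_mul_pinfty//.
have H := @lebesgue_measure_itv R `[- m, m]; rewrite [X in X \is a _]H /=.
by case: ifP.
Qed.

Lemma measurable_ball_cV n (m : R) :
  measurable [set x : 'cV[R]_n | dot x x <= m].
Proof.
have mdot : measurable_fun setT (fun x : 'cV[R]_n => dot x x : measurableTypeR R).
  by apply: measurable_sum => j; apply: measurable_funM; exact: measurable_coord.
have -> : [set x : 'cV[R]_n | dot x x <= m] =
    (fun x : 'cV[R]_n => dot x x : measurableTypeR R) @^-1` `]-oo, m]%classic.
  by apply/seteqP; split => x /=; rewrite in_itv.
exact: measurable_preimage.
Qed.

(** Each ball lies in a cube, hence has finite measure. If all balls were null, so would be their
    countable union, the whole space. *)
Lemma lebesgue_cV_ball n : exists2 m : R, 0 <= m &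
  (0 < leb n [set x | (dot x x <= m)%R] < +oo)%E.
Proof.
have fin m : 0 <= m -> (leb n [set x | (dot x x <= m)%R] < +oo)%E.
  move=> m0; apply: le_lt_trans (@lebesgue_cV_cube n (Num.sqrt m) _); last exact: sqrtr_ge0.
  apply: le_measure; rewrite ?inE; [exact: measurable_ball_cV|exact: measurable_cube|].
  move=> x /= xm i; rewrite -sqrtr_sqr ler_sqrt//; apply: le_trans xm.
  rewrite /dot (bigD1 i)//= lerDl sumr_ge0// => j _.
  by rewrite -expr2 sqr_ge0.
have [[m m0 pos]|H] := pselect (exists2 m : R, 0 <= m &
    (0 < leb n [set x | (dot x x <= m)%R])%E).
  by exists m => //; rewrite pos fin.
have := lebesgue_cV_gt0 n.
rewrite (_ : setT = \bigcup_m [set x : 'cV[R]_n | (dot x x <= m%:R)%R]); last first.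
  apply/esym; rewrite -subTset => x _; exists (Num.trunc (dot x x)).+1 => //=.
  exact/ltW/truncnS_gt.
move=> pos; exfalso; move: pos; apply/negP; rewrite -leNgt.
apply: le_trans (measure_sigma_subadditive _ _ _ (@subset_refl _ _)) _ => //.
- by move=> k; exact: measurable_ball_cV.
- by apply: bigcup_measurable => k _; exact: measurable_ball_cV.
rewrite eseries0// => k _ _; apply/eqP; rewrite eq_le measure_ge0 andbT leNgt.
by apply/negP => pos; apply: H; exists k%:R.
Qed.

(* Both sides evaluate the product measure of {(x, y) | x \in A, x + M y \in B}
   for a ball A, which is symmetric and invariant under M. *)
Lemma lebesgue_cV_orthogonal n (M : 'M[R]_n) (B : set 'cV[R]_n) :
  orthogonal_mx M -> measurable B -> leb n ((fun x => M *m x) @^-1` B) = leb n B.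
Proof.
move=> oM mB; have [m m0 /andP[A0 Afin]] := lebesgue_cV_ball n.
have MT : M *m M^T = 1%:M by exact: mulmx1C.
set A := [set x : 'cV[R]_n | _] in A0 Afin.
have mA : measurable A := @measurable_ball_cV n m.
pose S := [set p : 'cV[R]_n * 'cV[R]_n | A p.1 /\ B (p.1 + M *m p.2)].
pose S' := [set p : 'cV[R]_n * 'cV[R]_n | B p.1 /\ A (p.1 - M *m p.2)].
have mS : measurable S.
  apply: measurableI; first exact: (measurable_preimage measurable_fst).
  apply: (measurable_preimage (f := fun p : 'cV[R]_n * 'cV[R]_n => p.1 + M *m p.2)) => //.
  apply: measurable_cVD => //.
  exact: (measurableT_comp (measurable_mulmx M) measurable_snd).
have mS' : measurable S'.
  apply: measurableI; first exact: (measurable_preimage measurable_fst).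
  apply: (measurable_preimage (f := fun p : 'cV[R]_n * 'cV[R]_n => p.1 - M *m p.2)) => //.
  apply: (eq_measurable_fun (fun p : 'cV[R]_n * 'cV[R]_n => p.1 + (- M) *m p.2)).
    by move=> p _; rewrite mulNmx.
  apply: measurable_cVD => //.
  exact: (measurableT_comp (measurable_mulmx (- M)) measurable_snd).
(* As [x + M *m y = M *m (y + M^T *m x)], the section of [S] over a point [x] of [A] is a translate
   of the preimage of [B]. *)
have SE : (leb n \x leb n)%E S = (leb n A * leb n ((fun x => M *m x) @^-1` B))%E.
  rewrite muleC -integral_cst//.
  transitivity (\int[leb n]_(x in A) leb n ((fun x => M *m x) @^-1` B))%E => //.
  rewrite integral_mkcond; apply: eq_integral => x _ /=; rewrite patchE.
  case: ifPn => [|/negP] xA; last first.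
    rewrite (_ : xsection S x = set0) ?measure0//.
    apply/seteqP; split => // y; rewrite /xsection/= inE => -[/= Ax _].
    by apply: xA; rewrite inE.
  rewrite inE in xA.
  rewrite -[RHS](@lebesgue_cVD n (M^T *m x))//; last first.
    by apply: (measurable_preimage (measurable_mulmx M)).
  congr (leb n _); apply/seteqP.
  have E y : M *m (y + M^T *m x) = x + M *m y.
    by rewrite mulmxDr mulmxA MT mul1mx addrC.
  split => y; rewrite /xsection/= inE /S /= E; first by case.
  by move=> By; split.
(* By invariance of [dot] under [M] and under sign change, the section of [S'] over a point [x] of
   [B] is the ball [A] translated by [M^T *m x]. *)
have S'E : (leb n \x leb n)%E S' = (leb n B * leb n A)%E.
  rewrite muleC -integral_cst// integral_mkcond.
  apply: eq_integral => x _ /=; rewrite patchE.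
  case: ifPn => [|/negP] xB; last first.
    rewrite (_ : xsection S' x = set0) ?measure0//.
    apply/seteqP; split => // y; rewrite /xsection/= inE => -[/= Bx _].
    by apply: xB; rewrite inE.
  rewrite inE in xB.
  rewrite -[RHS](@lebesgue_cVD n (- (M^T *m x)))//.
  congr (leb n _); apply/seteqP.
  have E y : dot (y - M^T *m x) (y - M^T *m x) = dot (x - M *m y) (x - M *m y).
    rewrite -(dot_orthogonal _ _ oM) -[RHS]dotNN; congr dot;
    by rewrite mulmxBr mulmxA MT mul1mx opprB.
  split => y; rewrite /xsection/= inE /S' /A /= E; first by case.
  by move=> By; split.
(* For fixed [y], translating [x] by [M *m y] carries one section to the other; this needs the
   iterated integral with [y] outside. *)
have SS' : (leb n \x^ leb n)%E S = (leb n \x^ leb n)%E S'.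
  apply: eq_integral => y _ /=; rewrite -(@lebesgue_cVD n (- (M *m y)) (ysection S y)).
    congr (leb n _); apply/seteqP; split => x;
    by rewrite /ysection/= !inE /S /S' /= subrK => -[].
  exact: measurable_ysection.
have prodE Z : measurable Z -> (leb n \x leb n)%E Z = (leb n \x^ leb n)%E Z.
  move=> mZ; apply: product_measure_unique => // C D mC mD.
  exact: product_measure2E.
move: (prodE _ mS'); rewrite -SS' -prodE// SE S'E muleC.
(* The common factor [leb n A] is positive and finite, so it cancels. *)
have fA : leb n A \is a fin_num by rewrite ge0_fin_numE.
by move=> E; apply/le_anti/andP; split; rewrite -(lee_pmul2l fA A0) E.
Qed.
End lebesgue_invariance.

(** * Integrals of nonmeasurable functions *)

Section inner_integral.
Local Open Scope ereal_scope.
Import HBNNSimple.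
Context d (T : measurableType d) (R : realType).
Variable mu : {measure set T -> \bar R}.
Implicit Types f g : T -> \bar R.

(** The integral of a nonnegative function is a supremum over simple functions below it, so
    monotonicity extends to nonmeasurable integrands. *)
Lemma ge0_le_integralT f g : (forall x, 0 <= f x) -> (forall x, f x <= g x) ->
  \int[mu]_x f x <= \int[mu]_x g x.
Proof.
move=> f0 fg; have g0 x : 0 <= g x := le_trans (f0 x) (fg x).
rewrite !ge0_integralTE//; apply: le_ereal_sup => _ [h /= hf <-].
by exists h => // x; exact: le_trans (hf x) (fg x).
Qed.

(* The integral of a possibly nonmeasurable function f >= 0 is a supremum over
   the simple functions below f; it is attained at a measurable function. *)
Lemma ge0_integral_minorant f : (forall x, 0 <= f x) ->
  exists H, [/\ measurable_fun setT H, forall x, 0 <= H x, forall x, H x <= f x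
              & \int[mu]_x H x = \int[mu]_x f x].
Proof.
move=> f0.
pose S := [set sintegral mu h | h in
  [set h : {nnsfun T >-> R} | forall x, (h x)%:E <= f x]].
have fE : \int[mu]_x f x = ereal_sup S by rewrite ge0_integralTE.
have S0 : S !=set0 by exists (sintegral mu nnsfun0), nnsfun0.
have [u uS ucvg] := ereal_sup_seq (proj2 (set0P _) S0).
have /choice[h hP] n : exists h : {nnsfun T >-> R},
    (forall x, (h x)%:E <= f x) /\ sintegral mu h = u n.
  by have [h hf <-] := uS n; exists h.
(* The supremum of all [h n]: measurable as a countable supremum, still below [f], and above each
   term of a maximizing sequence. *)
pose H x := esups (fun n => (h n x)%:E) 0%N.
have hH n x : (h n x)%:E <= H x by apply: ereal_sup_ubound; exists n.
have H0 x : 0 <= H x by apply: le_trans (hH 0%N x); rewrite lee_fin.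
have Hf x : H x <= f x.
  by apply: ge_ereal_sup => _ [n _ <-]; have [] := hP n.
exists H; split => //.
  apply: (@measurable_fun_esups _ _ _ setT (fun n x => (h n x)%:E)) => n.
  by apply/measurable_EFinP; exact: measurable_funP.
apply/le_anti/andP; split; first exact: ge0_le_integralT.
rewrite fE -(cvg_lim _ ucvg)//; apply: lime_le; first by apply/cvg_ex; eexists; exact: ucvg.
apply: nearW => n; have [_ <-] := hP n.
by rewrite -integralT_nnsfun; apply: ge0_le_integralT => // x; rewrite lee_fin.
Qed.

Lemma integral_preimage_patch (phi : T -> T) (B : set T) f :
  \int[mu]_(x in phi @^-1` B) f (phi x) = \int[mu]_x (f \_ B) (phi x).
Proof. by rewrite integral_mkcond; apply: eq_integral => x _; rewrite !patchE. Qed.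

Section change_of_variables.
Variables phi psi : T -> T.
Hypothesis mphi : measurable_fun setT phi.
Hypothesis mpsi : measurable_fun setT psi.
Hypothesis phiK : cancel phi psi.
Hypothesis psiK : cancel psi phi.
Hypothesis muphi : forall A, measurable A -> mu (phi @^-1` A) = mu A.

(** The pushforward formula is applied to a measurable minorant of [f] with the same integral. *)
Let le_change (chi : T -> T) f : measurable_fun setT chi ->
  (forall A, measurable A -> mu (chi @^-1` A) = mu A) ->
  (forall x, 0 <= f x) -> \int[mu]_x f x <= \int[mu]_x f (chi x).
Proof.
move=> mchi muchi f0; have [H [mH H0 Hf <-]] := ge0_integral_minorant f0.
apply: (@le_trans _ _ (\int[mu]_x H (chi x))); last first.
  by apply: ge0_le_integralT.
rewrite -[leRHS]/(\int[mu]_(x in chi @^-1` setT) (H \o chi) x).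
rewrite -(ge0_integral_pushforward mchi)//.
rewrite le_eqVlt; apply/orP; left; apply/eqP/eq_measure_integral => A mA _.
by rewrite -[LHS]muchi.
Qed.

Let ge0_change f : (forall x, 0 <= f x) -> \int[mu]_x f (phi x) = \int[mu]_x f x.
Proof.
move=> f0; apply/le_anti/andP; split; last exact: le_change.
(* The remaining inequality is [le_change] for the inverse map [psi] and the function [f \o phi]. *)
have -> : \int[mu]_x f x = \int[mu]_x f (phi (psi x)).
  by apply: eq_integral => x _; rewrite psiK.
apply: (le_change (f := f \o phi)) => // [A mA|x]; last exact: f0.
rewrite -[LHS]muphi; first by rewrite -comp_preimage (_ : psi \o phi = id)//; exact/funext.
by rewrite -[X in measurable X]setTI; exact: mpsi.
Qed.

(** The function [f] is arbitrary because it will be the Dunkl density, whose kernel is picked by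
    [xget] and carries no measurability information. Positive and negative parts reduce to the
    nonnegative case. *)
Lemma integral_change (B : set T) f :
  \int[mu]_(x in phi @^-1` B) f (phi x) = \int[mu]_(x in B) f x.
Proof.
rewrite integral_preimage_patch [RHS]integral_mkcond.
rewrite integralE [RHS]integralE; congr (_ - _).
- rewrite -(ge0_change (f := (f \_ B)^\+)); last exact: funepos_ge0.
  by apply: eq_integral => x _; rewrite !funeposE.
- rewrite -(ge0_change (f := (f \_ B)^\-)); last exact: funeneg_ge0.
  by apply: eq_integral => x _; rewrite !funenegE.
Qed.

End change_of_variables.

Let ge0_ae_le (N : set T) f g : measurable N -> mu N = 0 ->
  (forall x, 0 <= f x) -> (forall x, 0 <= g x) -> (forall x, ~ N x -> f x = g x) ->
  \int[mu]_x f x <= \int[mu]_x g x.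
Proof.
move=> mN N0 f0 g0 fg; have [H [mH H0 Hf <-]] := ge0_integral_minorant f0.
rewrite (@ge0_negligible_integral _ _ _ _ _ N)// integral_mkcond.
apply: ge0_le_integralT => x; rewrite patchE; case: ifPn => // /[!inE] -[_ Nx].
by rewrite -fg.
Qed.

Lemma eq_integral_off_null (N D : set T) f g : measurable N -> mu N = 0 ->
  (forall x, ~ N x -> f x = g x) -> \int[mu]_(x in D) f x = \int[mu]_(x in D) g x.
Proof.
move=> mN N0 fg; rewrite integral_mkcond [RHS]integral_mkcond.
have {}fg x : ~ N x -> (f \_ D) x = (g \_ D) x by move=> /fg; rewrite !patchE => ->.
have gf x : ~ N x -> (g \_ D) x = (f \_ D) x by move=> /fg ->.
rewrite integralE [RHS]integralE; congr (_ - _); apply/le_anti/andP; split;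
  apply: (ge0_ae_le mN N0) => // x Nx; by rewrite ?funeposE ?funenegE (fg,gf).
Qed.

(** A measurable minorant [H] of [g] has the same finite integral as [F], so [F - H] vanishes almost
    everywhere and [g] is squeezed in between. Here [g] will be [F] cut off to a set of unknown
    measurability. *)
Lemma ge0_le_integral_eq (F : T -> R) g : measurable_fun setT F ->
  (forall x, 0 <= g x) -> (forall x, g x <= (F x)%:E) ->
  \int[mu]_x g x = \int[mu]_x (F x)%:E -> \int[mu]_x (F x)%:E < +oo ->
  exists N, [/\ measurable N, mu N = 0 & forall x, ~ N x -> g x = (F x)%:E].
Proof.
move=> mF g0 gF gFE Foo; have [H [mH H0 Hg HE]] := ge0_integral_minorant g0.
have F0 x : 0 <= (F x)%:E := le_trans (g0 x) (gF x).
have iF : mu.-integrable setT (EFin \o F).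
  apply/integrableP; split; first exact/measurable_EFinP.
  by rewrite (eq_integral (EFin \o F))// => x _; exact/gee0_abs/F0.
have iH : mu.-integrable setT H.
  apply/integrableP; split => //.
  by rewrite (eq_integral H) ?HE ?gFE// => x _; exact/gee0_abs/H0.
have mFH : measurable_fun setT ((EFin \o F) \- H).
  by apply: emeasurable_funB => //; exact/measurable_EFinP.
have FH0 x : 0 <= ((EFin \o F) \- H) x.
  by rewrite /= sube_ge0 ?orbT//; exact: le_trans (Hg x) (gF x).
have := ae_eq_integral_abs mu measurableT mFH.
rewrite (eq_integral ((EFin \o F) \- H)); last by move=> x _; exact/gee0_abs/FH0.
rewrite integralB//= HE gFE subee; last by rewrite ge0_fin_numE// integral_ge0.
move=> [/(_ erefl)[N [mN N0 HN]] _]; exists N; split => // x Nx.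
have : (F x)%:E - H x = 0.
  by apply: contrapT => FHx; apply: Nx; apply: HN => /= K; exact/FHx/K.
move: (H0 x) (Hg x) (gF x); case: (H x) => [r| |] //= _.
move=> rg gFx; rewrite -EFinB => -[/eqP]; rewrite subr_eq0 => /eqP Fr.
by apply/le_anti; rewrite gFx Fr.
Qed.

End inner_integral.

Lemma integral_cV_orthogonal (R : realType) (n : nat) (M : 'M[R]_n)
    (B : set 'cV[R]_n) (f : 'cV[R]_n -> \bar R) : orthogonal_mx M ->
  (\int[lebesgue_cV n]_(x in (fun x => M *m x) @^-1` B) f (M *m x) =
   \int[lebesgue_cV n]_(x in B) f x)%E.
Proof.
move=> oM; apply: (integral_change (psi := fun x => M^T *m x)).
- exact: measurable_mulmx.
- exact: measurable_mulmx.
- by move=> x; rewrite mulmxA oM mul1mx.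
- by move=> x; rewrite mulmxA (mulmx1C oM) mul1mx.
- by move=> A mA; exact: lebesgue_cV_orthogonal.
Qed.

(** * Regularity of real analytic functions *)

Section real_analytic_regularity.
Context {R : realType} {n : nat}.
Implicit Types (f : 'cV[R]_n -> R) (x v h w : 'cV[R]_n).
Implicit Types (m : {ffun 'I_n -> nat}).

Definition degree m := (\sum_i m i)%N.

Lemma monomialZ m (s : R) h : monomial m (s *: h) = s ^+ degree m * monomial m h.
Proof.
rewrite /monomial /degree -prodrXr -big_split /=.
by apply: eq_bigr => i _; rewrite mxE exprMn.
Qed.

Lemma degree_eq0 m : degree m = 0%N -> forall h, monomial m h = 1.
Proof.
move=> /eqP; rewrite sum_nat_eq0 => /forallP m0 h.
by apply: big1 => i _; rewrite (eqP (m0 i)) expr0.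
Qed.

Lemma monomial0 m : monomial m (0 : 'cV[R]_n) = (degree m == 0%N)%:R.
Proof.
have [/degree_eq0 ->//|d0] := eqVneq (degree m) 0%N.
by rewrite -(scale0r 0) monomialZ expr0n (negbTE d0) mul0r.
Qed.

Lemma ler_monomial m (s : R) h w : 0 <= s ->
  (forall i, `|h i 0| <= s * w i 0) ->
  `|monomial m h| <= s ^+ degree m * monomial m w.
Proof.
move=> s0 hw; rewrite -monomialZ normr_prod; apply: ler_prod => i _.
by rewrite normr_ge0 /= mxE normrX lerXn2r// nnegrE ?(le_trans _ (hw i)).
Qed.

(** Here [M] bounds the absolute series at the corner [(rho, ..., rho)] of a polydisc. The last
    clause is a dominated estimate: replacing the monomials by quantities [A m] of relative size at
    most [K] gives a limit of size at most [K * M]. It stands in for termwise limits and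
    differentiation. *)
Lemma real_analytic_bound f x : real_analytic f -> exists rho : R, 0 < rho /\
  exists c : {ffun 'I_n -> nat} -> R, exists2 M : R, 0 <= M &
  (forall h, (forall i, `|h i 0| <= rho) ->
     (\sum_(m : {ffun 'I_n -> 'I_N}) c (multi_index m) * monomial (multi_index m) h)
       @[N --> \oo] --> f (x + h)) /\
  (forall (K : R) (A : {ffun 'I_n -> nat} -> R) (l : R), 0 <= K ->
     (forall m, `|A m| <= K * monomial m (const_mx rho)) ->
     (\sum_(m : {ffun 'I_n -> 'I_N}) c (multi_index m) * A (multi_index m))
       @[N --> \oo] --> l ->
     `|l| <= K * M).
Proof.
move=> /(_ x)[r r0 [c H]].
have rr : r / 2 < r by rewrite ltr_pdivrMr// mulr_natr mulr2n ltrDl.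
have r20 : 0 < r / 2 by rewrite divr_gt0.
exists (r / 2); split => //; exists c.
have hc : cvgn (fun N => \sum_(m : {ffun 'I_n -> 'I_N})
      `|c (multi_index m) * monomial (multi_index m) (const_mx (r / 2))|).
  have [] // := H (const_mx (r / 2)).
  by move=> i; rewrite mxE gtr0_norm.
(* Boundedness only says that every number strictly above [M0] is a bound, hence [M0 + 1]. *)
have [M0 [_ /(_ (M0 + 1))]] := cvg_seq_bounded hc.
rewrite ltrDl => /(_ ltr01); set M := M0 + 1 => MP.
have {}MP N : \sum_(m : {ffun 'I_n -> 'I_N})
    `|c (multi_index m) * monomial (multi_index m) (const_mx (r / 2))| <= M.
  by apply: le_trans (ler_norm _) _; exact: MP.
exists M; first by apply: le_trans (MP 0%N); exact: sumr_ge0.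
split=> [h hr|K A l K0 AK Al].
  by have [] := H h (fun i => le_lt_trans (hr i) rr).
apply: (cvgr_to_le (cvg_norm Al)); apply: nearW => N.
apply: le_trans (ler_norm_sum _ _ _) _.
apply: (@le_trans _ _ (K * \sum_(m : {ffun 'I_n -> 'I_N})
    `|c (multi_index m) * monomial (multi_index m) (const_mx (r / 2))|)).
  rewrite mulr_sumr; apply: ler_sum => m _; rewrite !normrM mulrCA.
  apply: ler_wpM2l => //; apply: le_trans (AK _) _; apply: ler_wpM2l => //.
  exact: ler_norm.
exact: ler_wpM2l.
Qed.

Lemma normr_entry_le h i : `|h i 0| <= `|h|.
Proof.
by rewrite [leRHS]/Num.norm /= mx_normrE; apply/bigmax_geP; right; exists (i, 0).
Qed.

(** In the series of [f y - f x] the constant term cancels, and a term of degree [d > 0] shrinks by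
    [s ^+ d <= s] when [y - x] lies in the polydisc scaled by [s <= 1]. *)
Lemma real_analytic_continuous f : real_analytic f -> continuous f.
Proof.
move=> fA x; have [rho [rho0 [c [M M0 [cf bound]]]]] := real_analytic_bound x fA.
apply: (proj2 (@cvgrPdist_le _ _ _ _ (nbhs_filter x) _ _)) => e e0.
pose s := Num.min 1 (e / (M + 1)).
have M10 : 0 < M + 1 by lra.
have s0 : 0 < s by rewrite lt_min ltr01 divr_gt0.
have s1 : s <= 1 by rewrite ge_min lexx.
have near_x : \forall y \near x, `|x - y| <= s * rho.
  by apply/nbhs_normP; exists (s * rho) => [|y /ltW]; rewrite //= mulr_gt0.
near=> y.
have yx : `|y - x| <= s * rho by rewrite distrC; near: y.
have hi i : `|(y - x) i 0| <= s * rho := le_trans (normr_entry_le _ i) yx.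
have hr i : `|(y - x) i 0| <= rho.
  by apply: le_trans (hi i) _; rewrite ger_pMl.
rewrite distrC; apply: (@le_trans _ _ (s * M)).
  apply: (bound s (fun m => monomial m (y - x) - monomial m 0)).
  - exact: ltW.
  - move=> m; rewrite monomial0; have [d0|d0] := eqVneq (degree m) 0%N.
      by rewrite !(degree_eq0 d0) subrr normr0 mulr1 ltW.
    rewrite subr0; apply: le_trans (ler_monomial _ (w := const_mx rho) (ltW s0) _) _.
      by move=> i; rewrite [const_mx _ _ _]mxE.
    apply: ler_wpM2r.
      by apply: prodr_ge0 => i _; rewrite mxE exprn_ge0// ltW.
    by rewrite -[leRHS]expr1 ler_wiXn2l// ?ltW// lt0n.
  - rewrite -[in f y](subrKC x y) -[in f x](addr0 x).
    under eq_fun => N do under eq_bigr => m _ do rewrite mulrBr.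
    under eq_fun => N do rewrite sumrB.
    by apply: cvgB; apply: cf => // i; rewrite mxE normr0 ltW.
apply: (@le_trans _ _ (s * (M + 1))); first by rewrite ler_pM2l//; lra.
by rewrite -ler_pdivlMr// ge_min lexx orbT.
Unshelve. all: by end_near. Qed.

(* The difference quotients are Cauchy: on a monomial of degree k they are
   s ^ (k - 1), constant in s for k = 1 and at most s for larger k. *)
Lemma real_analytic_derivable f x v : real_analytic f -> derivable f x v.
Proof.
move=> fA; have [rho [rho0 [c [M M0 [cf bound]]]]] := real_analytic_bound x fA.
(* For [|s| <= s0] the point [s *: v] stays in the polydisc of radius [rho]; the [+ 1] covers
   [v = 0]. *)
pose s0 := rho / (`|v| + 1).
have v1 : 0 < `|v| + 1 by rewrite ltr_wpDl.
have s00 : 0 < s0 by rewrite divr_gt0.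
have vs i : s0 * `|v i 0| <= rho.
  rewrite /s0 mulrAC ler_pdivrMr// ler_pM2l//.
  by apply: le_trans (normr_entry_le _ _) _; rewrite lerDl.
pose q s := s^-1 *: ((f \o shift x) (s *: v) - f x).
(* The difference quotient at 0 of [s ^+ k], including the value 0 for the constant [k = 0]. *)
pose phi k (s : R) : R := if k is k'.+1 then s ^+ k' else 0.
have qE s : s != 0 -> `|s| <= s0 ->
    (\sum_(m : {ffun 'I_n -> 'I_N})
       c (multi_index m) * (monomial (multi_index m) v * phi (degree (multi_index m)) s))
    @[N --> \oo] --> q s.
  move=> s_neq0 ss0; rewrite /q /= [s *: v + x]addrC.
  have E m : monomial m v * phi (degree m) s = s^-1 * (monomial m (s *: v) - monomial m 0).
    rewrite monomial0 monomialZ; case: (degree m) (@degree_eq0 m) => [/(_ erefl) ->|k _] /=.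
      by rewrite mulr0 expr0 mulr1 subrr mulr0.
    by rewrite subr0 exprS; field.
  under eq_fun => N do under eq_bigr => m _ do rewrite E mulrCA mulrBr.
  under eq_fun => N do rewrite -mulr_sumr sumrB.
  apply: cvgM; [exact: cvg_cst|apply: cvgB].
    by apply: cf => i; rewrite mxE normrM; apply: le_trans (vs i); exact: ler_wpM2r.
  by rewrite -[in f x](addr0 x); apply: cf => // i; rewrite mxE normr0 ltW.
(* Degrees 0 and 1 cancel. In degree [k + 2] each quotient is at most [eta * s0 ^+ k], which is
   [eta / s0 ^+ 2] times the [s0 ^+ (k + 2)] absorbed by the monomial at [rho]. *)
have cauchy s t (eta : R) : s != 0 -> t != 0 -> 0 < eta -> eta <= s0 ->
    `|s| <= eta -> `|t| <= eta -> `|q s - q t| <= 2 * eta / s0 ^+ 2 * M.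
  move=> sn0 tn0 eta0 etas0 se te.
  apply: (bound _ (fun m =>
    monomial m v * phi (degree m) s - monomial m v * phi (degree m) t)).
  - by rewrite divr_ge0 ?sqr_ge0// mulr_ge0// ltW.
  - move=> m.
    have mv : `|monomial m v| * s0 ^+ degree m <= monomial m (const_mx rho).
      have := @ler_monomial m 1 (s0 *: v) (const_mx rho) ler01.
      rewrite expr1n mul1r monomialZ normrM normrX (gtr0_norm s00) mulrC; apply => i.
      by rewrite mul1r !mxE normrM gtr0_norm.
    rewrite -mulrBr normrM.
    apply: le_trans (ler_wpM2l _ mv); last first.
      by rewrite divr_ge0 ?sqr_ge0// mulr_ge0// ltW.
    rewrite mulrCA; apply: ler_wpM2l => //.
    case: (degree m) => [|[|k]] /=; rewrite ?subrr ?normr0.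
    + by rewrite !mulr_ge0 ?invr_ge0 ?sqr_ge0// ltW.
    + by rewrite !mulr_ge0 ?invr_ge0 ?sqr_ge0// ltW.
    have P u : `|u| <= eta -> `|u ^+ k.+1| <= eta * s0 ^+ k.
      move=> ue; rewrite normrX exprS; apply: ler_pM => //.
      by rewrite lerXn2r ?nnegrE ?(ltW s00)// (le_trans ue).
    apply: le_trans (ler_normB _ _) _; apply: le_trans (lerD (P _ se) (P _ te)) _.
    rewrite (_ : 2 * eta / s0 ^+ 2 * s0 ^+ k.+2 = 2 * (eta * s0 ^+ k)); first by lra.
    have -> : s0 ^+ k.+2 = s0 ^+ 2 * s0 ^+ k by rewrite -exprD.
    by field; rewrite gt_eqF.
  - under eq_fun => N do under eq_bigr => m _ do rewrite mulrBr.
    under eq_fun => N do rewrite sumrB.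
    by apply: cvgB; apply: qE => //; apply: le_trans etas0.
apply: cauchy_cvg; apply: cauchy_exP => e e0.
have M1 : 0 < M + 1 by lra.
(* Chosen to make the Cauchy bound [2 * eta / s0 ^+ 2 * (M + 1)] at most [e / 2]. *)
pose eta := Num.min s0 (e * s0 ^+ 2 / (4 * (M + 1))).
have s020 : 0 < s0 ^+ 2 by rewrite exprn_gt0.
have eta0 : 0 < eta by rewrite lt_min s00 !divr_gt0 ?mulr_gt0.
exists (q eta).
suff : \forall s \near 0^', ball (q eta) e (q s) by [].
near=> s.
have se : `|s| <= eta by near: s; exact: dnbhs0_le.
have sn0 : s != 0 by near: s; exact: nbhs_dnbhs_neq.
rewrite /ball /= /ball_; apply: le_lt_trans (cauchy _ _ eta _ _ _ _ _ _) _ => //.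
- by rewrite gt_eqF.
- by rewrite ge_min lexx.
- by rewrite gtr0_norm.
apply: (@le_lt_trans _ _ (2 * eta / s0 ^+ 2 * (M + 1))).
  by apply: ler_wpM2l; [rewrite divr_ge0 ?mulr_ge0 ?ltW|lra].
apply: (@le_lt_trans _ _ (e / 2)); last by lra.
rewrite mulrAC ler_pdivrMr//.
have : eta <= e * s0 ^+ 2 / (4 * (M + 1)) by rewrite ge_min lexx orbT.
rewrite ler_pdivlMr ?mulr_gt0//; lra.
Unshelve. all: by end_near. Qed.

Lemma real_analytic_scale f (a : R) : 0 < a ->
  real_analytic f -> real_analytic (fun x => f (a *: x)).
Proof.
move=> a0 fA x; have [r r0 [c H]] := fA (a *: x).
exists (r / a); first exact: divr_gt0.
exists (fun m => c m * a ^+ degree m) => h hr.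
have ah i : `|(a *: h) i 0| < r.
  by rewrite mxE normrM gtr0_norm// mulrC -ltr_pdivlMr.
have E m : c m * a ^+ degree m * monomial m h = c m * monomial m (a *: h).
  by rewrite monomialZ mulrA.
have [H1 H2] := H _ ah; split.
  by under eq_fun => N do under eq_bigr => m _ do rewrite E.
by under eq_fun => N do under eq_bigr => m _ do rewrite E; rewrite scalerDr.
Qed.

End real_analytic_regularity.

(** * Uniqueness of the Dunkl kernel *)

Section dunkl_uniqueness.
Context {R : realType} {n : nat}.
Implicit Types (f g h : 'cV[R]_n -> R) (x y a : 'cV[R]_n).

Lemma dot_continuous : continuous (fun x : 'cV[R]_n => dot x x).
Proof.
apply: (@continuous_big _ _ +%R 0 xpredT) => [p|i _ x].
  exact: add_continuous.
by apply: continuousM; exact: coord_continuous.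
Qed.

Lemma trmx_continuous p q : continuous (@trmx R p q).
Proof.
move=> x; apply: (proj2 (@cvgrPdist_le _ _ _ _ (nbhs_filter x) _ _)) => e e0.
apply: (proj2 (nbhs_normP (V := 'M[R]_(p, q)) x _)).
exists e => //= z /= /ltW xz; apply: le_trans xz.
rewrite -linearB /= {1}/Num.norm /= mx_normrE; apply: bigmax_le => // -[i j] _ /=.
rewrite mxE [leRHS]/Num.norm /= mx_normrE; apply/bigmax_geP; right.
by exists (j, i).
Qed.

(** Bounded closed sets of row vectors are compact; transposition, which is continuous, carries this
    to columns. *)
Lemma compact_ball_cV (r : R) : compact [set x : 'cV[R]_n | dot x x <= r].
Proof.
have -> : [set x : 'cV[R]_n | dot x x <= r] =
    trmx @` [set v : 'rV[R]_n | dot v^T v^T <= r].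
  apply/seteqP; split => [x xr|_ [v vr <-]//].
  by exists x^T; rewrite /= trmxK.
apply: continuous_compact; first exact/continuous_subspaceT/trmx_continuous.
apply: bounded_closed_compact.
  exists (Num.sqrt r); split; first exact: num_real.
  move=> M rM v /= vr; rewrite [leLHS]/Num.norm /= mx_normrE.
  have M0 : 0 <= M by apply: le_trans (ltW rM); exact: sqrtr_ge0.
  apply: bigmax_le => // -[i j] _ /=; apply: le_trans (ltW rM).
  rewrite -sqrtr_sqr ler_wsqrtr//; apply: le_trans vr.
  rewrite /dot (bigD1 j)//= !mxE ord1 -expr2 lerDl sumr_ge0// => l _.
  by rewrite -expr2 sqr_ge0.
have -> : [set v : 'rV[R]_n | dot v^T v^T <= r] =
    (fun v : 'rV[R]_n => dot v^T v^T) @^-1` [set z | z <= r] by [].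
apply: closed_comp; last exact: closed_le.
move=> v _; apply: (@continuous_comp _ _ _ trmx (fun x => dot x x)).
  exact: trmx_continuous.
exact: dot_continuous.
Qed.

(** The norm that matrices carry is the maximum of the entries, hence a separate Euclidean one. *)
Definition eucl_norm x := Num.sqrt (dot x x).

Lemma eucl_norm_eq0 x : (eucl_norm x == 0) = (x == 0).
Proof. by rewrite sqrtr_eq0 -dot_eq0 eq_le dot_ge0 andbT. Qed.

Lemma eucl_normZ (s : R) x : 0 <= s -> eucl_norm (s *: x) = s * eucl_norm x.
Proof.
move=> s0; rewrite /eucl_norm dotZl dotZr mulrA sqrtrM ?mulr_ge0//.
by rewrite -expr2 sqrtr_sqr ger0_norm.
Qed.

(** Cauchy-Schwarz, from expanding the square of [eucl_norm y *: x - eucl_norm x *: y]. *)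
Lemma dot_le_eucl_norm x y : dot x y <= eucl_norm x * eucl_norm y.
Proof.
have [->|x0] := eqVneq x 0; first by rewrite dot0l mulr_ge0 ?sqrtr_ge0.
have [->|y0] := eqVneq y 0; first by rewrite dotC dot0l mulr_ge0 ?sqrtr_ge0.
have p z : z != 0 -> 0 < eucl_norm z by move=> z0; rewrite lt_def eucl_norm_eq0 z0 sqrtr_ge0.
have := dot_ge0 (eucl_norm y *: x - eucl_norm x *: y).
rewrite !(dotDl, dotDr, dotNl, dotNr, dotZl, dotZr) (dotC y x).
have e z : dot z z = eucl_norm z ^+ 2 by rewrite sqr_sqrtr ?dot_ge0.
rewrite (e x) (e y) => H.
have K : 0 <= 2 * (eucl_norm x * eucl_norm y) * (eucl_norm x * eucl_norm y - dot x y) by nra.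
by move: K; rewrite pmulr_rge0 ?subr_ge0// !mulr_gt0 ?p.
Qed.

Lemma dot_reflection a x : dot a a = 2 -> dot (reflection a x) (reflection a x) = dot x x.
Proof.
move=> a2; rewrite /reflection !(dotDl, dotDr, dotNl, dotNr, dotZl, dotZr) (dotC x a) a2.
by ring.
Qed.

Let radial_quotient h x :
  (fun t : R => t^-1 *: (((fun s : R => h (s *: x)) \o shift 1) (t *: 1) - h (1 *: x))) =
  (fun t : R => t^-1 *: ((h \o shift x) (t *: x) - h x)).
Proof.
by apply/funext => s /=; rewrite scale1r [s *: 1]mulr1 scalerDl scale1r.
Qed.

Lemma is_derive_radial h x : derivable h x x ->
  is_derive (1 : R) 1 (fun s : R => h (s *: x)) ('D_x h x).
Proof.
by move=> dh; split; rewrite /derivable /derive radial_quotient.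
Qed.

Lemma derive_left_max (phi : R -> R) (b : R) : derivable phi b 1 ->
  (\forall s \near b^'-, phi s <= phi b) -> 0 <= 'D_1 phi b.
Proof.
move=> dphi H; apply: (cvgr_to_ge (cvg_dnbhs_at_left dphi)).
have : \forall t \near 0^'-, phi (t + b) <= phi b.
  move: H; rewrite !near_withinE => /nbhs_normP[e /= e0 He]; apply/nbhs_normP.
  exists e => //= t /= te t0; apply: He; last by rewrite gtrDr.
  by rewrite /= opprD addrC subrK -sub0r.
apply: filterS2 (nbhs_left_lt _) => // t phit t0.
rewrite /= [t *: 1]mulr1 [X in 0 <= X](_ : _ = t^-1 * (phi (t + b) - phi b))//.
by rewrite nmulr_rge0 ?invr_lt0// subr_le0.
Qed.

Section maximum_principle.
Variables (s : seq 'cV[R]_n) (k : 'cV[R]_n -> R) (y : 'cV[R]_n).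
Hypothesis s2 : forall a, a \in s -> dot a a = 2.
Hypothesis k0 : forall a, a \in s -> 0 <= k a.

(* At a positive maximum of h(x) exp(- C |x|) on a ball the reflection terms are
   nonnegative, so for C > |y| the radial derivative is negative, which is
   impossible as the ball contains the segment from 0. *)
Lemma dunkl_max_principle h : continuous h -> (forall x, derivable h x x) ->
  h 0 = 0 ->
  (forall x, 'D_x h x + \sum_(a <- s) k a * (h x - h (reflection a x)) = dot x y * h x) ->
  forall x, h x <= 0.
Proof.
move=> hc hd h0 hE x0; rewrite leNgt; apply/negP => hx0.
pose C := eucl_norm y + 1.
pose phi x := h x * expR (- C * eucl_norm x).
pose K := [set x : 'cV[R]_n | dot x x <= dot x0 x0].
have cphi : continuous phi.
  move=> x; apply: (@continuousM _ _ h (fun x => expR (- C * eucl_norm x))).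
    exact: hc.
  apply: (@continuous_comp _ _ _ (fun x => - C * eucl_norm x) expR); last first.
    exact: continuous_expR.
  apply: (@continuousM _ _ (fun=> - C) eucl_norm); first exact: cst_continuous.
  apply: (@continuous_comp _ _ _ (fun x : 'cV[R]_n => dot x x) Num.sqrt); last first.
    exact: sqrt_continuous.
  exact: dot_continuous.
have [|c /[!inE] cK cmax] := @compact_EVT_max _ _ phi K _ (@compact_ball_cV _)
    (continuous_subspaceT cphi).
  by exists x0; rewrite /K /=.
have hpos : 0 < h c.
  have : phi x0 <= phi c by apply: cmax; rewrite inE /K /=.
  rewrite /phi => le1; rewrite -(pmulr_lgt0 _ (expR_gt0 (- C * eucl_norm c))).
  by apply: lt_le_trans le1; rewrite mulr_gt0 ?expR_gt0.
have c0 : c != 0 by apply/eqP => c0; rewrite c0 h0 ltxx in hpos.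
have r0 : 0 < eucl_norm c by rewrite lt_def eucl_norm_eq0 c0 sqrtr_ge0.
(* A reflection preserves the ball and the exponential factor, so maximality of [phi] at [c]
   compares the values of [h]. *)
have hrefl a : a \in s -> h (reflection a c) <= h c.
  move=> aR; have e : eucl_norm (reflection a c) = eucl_norm c.
    by rewrite /eucl_norm (dot_reflection _ (s2 aR)).
  have : phi (reflection a c) <= phi c.
    by apply: cmax; rewrite inE /K /= (dot_reflection _ (s2 aR)).
  by rewrite /phi e ler_pM2r// expR_gt0.
(* Drop the nonnegative reflection terms from [hE] and apply Cauchy-Schwarz. *)
have Dc : 'D_c h c <= eucl_norm c * eucl_norm y * h c.
  apply: (@le_trans _ _ (dot c y * h c)); last first.
    by rewrite ler_pM2r// dot_le_eucl_norm.
  rewrite -hE lerDl big_seq sumr_ge0// => a aR.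
  by rewrite mulr_ge0 ?k0// subr_ge0 hrefl.
(* This is [phi] along the ray through [c] for [t >= 0], written so that the exponent is linear in
   [t] and the norm need not be differentiated. *)
pose psi (t : R) := h (t *: c) * expR (- C * eucl_norm c * t).
have dh := is_derive_radial (hd c).
pose b := - C * eucl_norm c.
have dpsi : is_derive (1 : R) 1 psi
    (('D_c h c - C * eucl_norm c * h c) * expR (- C * eucl_norm c)).
  have db : is_derive (1 : R) 1 (fun t : R => b * t) b.
    by have := is_deriveZ b (is_derive_id (1 : R) 1); rewrite [b *: 1]mulr1.
  have de : is_derive (1 : R) 1 (fun t => expR (b * t)) (expR (b * 1) * b).
    exact: (is_derive1_comp (is_derive_expR (b * 1)) db).
  have := is_deriveM dh de.
  congr is_derive; rewrite scale1r mulr1 /b /GRing.scale /=; ring.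
have : 0 <= 'D_1 psi 1.
  apply: derive_left_max; first by case: dpsi.
  near=> t.
  have t0 : 0 <= t by near: t; exact/nbhs_left_ge/ltr01.
  have t1 : t <= 1 by near: t; exact/nbhs_left_le.
  have -> : psi t = phi (t *: c) by rewrite /psi /phi eucl_normZ// mulrA mulrAC.
  have -> : psi 1 = phi c by rewrite /psi /phi scale1r mulr1.
  apply: cmax; rewrite inE /K /=; apply: le_trans cK.
  by rewrite dotZl dotZr mulrA ger_pMl ?mulr_ile1// lt_def dot_eq0 c0 dot_ge0.
have [_ ->] := dpsi; rewrite leNgt => /negP; apply.
rewrite pmulr_llt0 ?expR_gt0// subr_lt0; apply: le_lt_trans Dc _.
by rewrite ltr_pM2r// /C mulrDl mul1r mulrC ltrDl.
Unshelve. all: by end_near. Qed.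

End maximum_principle.

(** For [xi = x] the factor [dot a xi] cancels the denominator; on the hyperplane of [a] it is 0,
    and so is the difference, as the reflection fixes [x]. *)
Lemma dunkl_operator_radial (Pp : {fset 'cV[R]_n}) k f x :
  dunkl_operator Pp k x f x =
  'D_x f x + \sum_(a <- Pp) k a * (f x - f (reflection a x)).
Proof.
congr (_ + _); apply: eq_bigr => a _; rewrite -mulrA /difference_quotient.
have [ax|ax] := eqVneq (dot a x) 0; last by rewrite [dot a x * _]mulrC divfK.
by rewrite /reflection ax scale0r subr0 subrr mul0r.
Qed.

Lemma dunkl_solution_unique (Pp : {fset 'cV[R]_n}) k y f g :
  (forall a, a \in Pp -> dot a a = 2) -> (forall a, a \in Pp -> 0 <= k a) ->
  continuous f -> (forall x, derivable f x x) ->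
  continuous g -> (forall x, derivable g x x) -> f 0 = g 0 ->
  (forall x, dunkl_operator Pp k x f x = dot x y * f x) ->
  (forall x, dunkl_operator Pp k x g x = dot x y * g x) -> f = g.
Proof.
move=> P2 k0.
(* By symmetry one inequality suffices, and it is the maximum principle for [f1 - g1]. *)
suff H f1 g1 : continuous f1 -> (forall x, derivable f1 x x) ->
    continuous g1 -> (forall x, derivable g1 x x) -> f1 0 = g1 0 ->
    (forall x, dunkl_operator Pp k x f1 x = dot x y * f1 x) ->
    (forall x, dunkl_operator Pp k x g1 x = dot x y * g1 x) ->
    forall x, f1 x <= g1 x.
  move=> cf df cg dg fg0 fE gE; apply/funext => x; apply/le_anti.
  by rewrite !H.
move=> cf df cg dg fg0 fE gE x; rewrite -subr_le0.
apply: (@dunkl_max_principle Pp k y P2 k0 (f1 - g1)) => [z|z||z].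
- by apply: continuousB; [exact: cf|exact: cg].
- exact: derivableB.
- by rewrite -[(f1 - g1) 0]/(f1 0 - g1 0) fg0 subrr.
rewrite deriveB// -[(f1 - g1) z]/(f1 z - g1 z) mulrBr -fE -gE !dunkl_operator_radial.
rewrite opprD addrACA -sumrB; congr (_ + _); apply: eq_bigr => a _.
by rewrite -mulrBr; congr (_ * _); rewrite -[(f1 - g1) _]/(f1 _ - g1 _); ring.
Qed.

End dunkl_uniqueness.

(** * Dunkl kernels and orthogonal maps *)

Section directional_derivatives.
Context {R : realType} {n : nat}.
Implicit Types (f : 'cV[R]_n -> R) (x v : 'cV[R]_n).

(** Only a directional derivative is given, so homogeneity is proved by substituting [t * a] for [t]
    in the difference quotient. *)
Lemma is_derive_dirZ f x v (a : R) : a != 0 -> derivable f x v ->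
  is_derive x (a *: v) f (a * 'D_v f x).
Proof.
move=> a0 df.
pose q (t : R) := t^-1 *: ((f \o shift x) (t *: v) - f x).
have cq : q t @[t --> 0^'] --> 'D_v f x by exact: df.
have ca : (t * a) @[t --> 0^'] --> 0^'.
  move=> A; rewrite !near_simpl !near_withinE => /nbhs_normP[e /= e0 eA].
  apply/nbhs_normP; exists (e / `|a|) => /=; first by rewrite divr_gt0// normr_gt0.
  move=> t /=; rewrite sub0r normrN ltr_pdivlMr ?normr_gt0// => te t0.
  by apply: eA; rewrite ?mulf_neq0//= sub0r normrN normrM.
have E : (fun t : R => t^-1 *: ((f \o shift x) (t *: (a *: v)) - f x)) =
    (fun t => a * q (t * a)).
  apply/funext => t; rewrite /q /= scalerA.
  have [->|t0] := eqVneq t 0; first by rewrite mul0r invr0 !scale0r mulr0.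
  by rewrite /GRing.scale /=; set X := _ - _; field; rewrite t0 a0.
have H : (fun t : R => t^-1 *: ((f \o shift x) (t *: (a *: v)) - f x)) t @[t --> 0^']
    --> a * 'D_v f x.
  rewrite E; apply: cvgM; first exact: cvg_cst.
  exact: (cvg_comp _ _ ca cq).
by split; [apply/cvg_ex; eexists; exact: H|exact: (cvg_lim _ H)].
Qed.

Lemma quotient_linear m (L : 'cV[R]_n -> 'cV[R]_m) (f : 'cV[R]_m -> R) x v : linear L ->
  (fun t : R => t^-1 *: (((f \o L) \o shift x) (t *: v) - (f \o L) x)) =
  (fun t => t^-1 *: ((f \o shift (L x)) (t *: L v) - f (L x))).
Proof. by move=> linL; apply/funext => t /=; rewrite linL. Qed.

Lemma derivable_linear m (L : 'cV[R]_n -> 'cV[R]_m) (f : 'cV[R]_m -> R) x v : linear L ->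
  derivable f (L x) (L v) -> derivable (f \o L) x v.
Proof. by move=> linL; rewrite /derivable quotient_linear. Qed.

Lemma derive_linear m (L : 'cV[R]_n -> 'cV[R]_m) (f : 'cV[R]_m -> R) x v : linear L ->
  'D_v (f \o L) x = 'D_(L v) f (L x).
Proof. by move=> linL; rewrite /derive quotient_linear. Qed.

Lemma mulmx_continuous (M : 'M[R]_n) : continuous (fun x : 'cV[R]_n => M *m x).
Proof.
move=> x; apply: (proj2 (@cvgrPdist_le _ _ _ _ (nbhs_filter x) _ _)) => e e0.
(* A Lipschitz constant of [M] for the maximum norm, made positive by the [+ 1]. *)
pose C : R := \sum_i \sum_j `|M i j| + 1.
have C0 : 0 < C by rewrite ltr_wpDl// sumr_ge0// => i _; rewrite sumr_ge0.
apply: (proj2 (nbhs_normP (V := 'cV[R]_n) x _)); exists (e / C); first exact: divr_gt0.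
move=> z /= /ltW; rewrite ler_pdivlMr// => xz; apply: le_trans xz.
rewrite -mulmxBr [leLHS]/Num.norm /= mx_normrE; apply: bigmax_le => [|[i j] _ /=].
  by rewrite mulr_ge0// ltW.
rewrite mxE; apply: le_trans (ler_norm_sum _ _ _) _.
apply: (@le_trans _ _ (\sum_l `|M i l| * `|x - z|)).
  by apply: ler_sum => l _; rewrite normrM ler_wpM2l// ord1 normr_entry_le.
rewrite -mulr_suml mulrC ler_wpM2l//.
have -> : C = \sum_j `|M i j| + (\sum_(l | l != i) \sum_j `|M l j| + 1).
  by rewrite /C (bigD1 i)//= addrA.
rewrite lerDl.
by rewrite addr_ge0// sumr_ge0// => l _; rewrite sumr_ge0.
Qed.

End directional_derivatives.

(** * Homogeneity of the Dunkl kernel *)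

Section dunkl_kernel_scaling.
Context {R : realType} {n : nat}.
Implicit Types (f : 'cV[R]_n -> R) (x y z a xi : 'cV[R]_n).
Implicit Types (Pp : {fset 'cV[R]_n}) (k : 'cV[R]_n -> R).

Lemma reflectionZ (c : R) a x : reflection a (c *: x) = c *: reflection a x.
Proof. by rewrite /reflection dotZr scalerBr scalerA. Qed.

Lemma scale_linear (c : R) : linear (fun x : 'cV[R]_n => c *: x).
Proof. by move=> t u v; rewrite scalerDr !scalerA mulrC. Qed.

(** The density at time [t] evaluates the kernel at [z / sqrt t], while existence will be known at
    almost every [z] from time 1; scaling bridges the two. *)
Lemma is_dunkl_kernelZ Pp k y f (c : R) : 0 < c ->
  is_dunkl_kernel Pp k y f -> is_dunkl_kernel Pp k (c *: y) (fun x => f (c *: x)).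
Proof.
move=> c0 [fA f0 fE]; have cn0 : c != 0 by rewrite gt_eqF.
split; [exact: real_analytic_scale|by rewrite scaler0|].
have D v x : 'D_v (fun x => f (c *: x)) x = c * 'D_v f (c *: x).
  rewrite [LHS](derive_linear f x v (scale_linear c)).
  have := is_derive_dirZ cn0 (@real_analytic_derivable _ _ f (c *: x) v fA).
  by case.
move=> xi x; rewrite dotZr -mulrA -fE /dunkl_operator D mulrDr mulr_sumr.
congr (_ + _); apply: eq_bigr => a _; rewrite mulrCA; congr (_ * _).
rewrite /difference_quotient D dotZr mulf_eq0 (negbTE cn0) /=.
case: ifPn => // ax; rewrite reflectionZ; set X := _ - _.
by field; rewrite cn0 ax.
Qed.

(** A kernel is 1 at the origin and the default function is 0, so this value detects existence. *)
Lemma dunkl_kernel0l Pp k y :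
  dunkl_kernel Pp k 0 y = (`[< exists f, is_dunkl_kernel Pp k y f >])%:R.
Proof.
rewrite /dunkl_kernel; case: asboolP => [[f fK]|nK].
  by have [_ ->] := @xgetPex _ (fun=> 0) [set f | is_dunkl_kernel Pp k y f] (ex_intro _ f fK).
by rewrite xgetPN// => f fK; apply: nK; exists f.
Qed.

End dunkl_kernel_scaling.

(** * Transport of the Dunkl data by an orthogonal map *)

Section dunkl_transport.
Context {R : realType} {n : nat}.
Variables (Phi : {fset 'cV[R]_n}) (k : 'cV[R]_n -> R) (theta : 'M[R]_n).
Hypothesis RPhi : root_system Phi.
Hypothesis mk : multiplicity_function Phi k.
Hypothesis otheta : orthogonal_mx theta.
Variables (Pp Pp' : {fset 'cV[R]_n}).
Hypothesis posPp : positive_subsystem Phi Pp.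
Hypothesis posPp' : positive_subsystem [fset theta *m a | a in Phi]%fset Pp'.
Implicit Types (f : 'cV[R]_n -> R) (x y z a xi : 'cV[R]_n).

Let k' : 'cV[R]_n -> R := fun a => k (theta^T *m a).

Let thetaK x : theta^T *m (theta *m x) = x.
Proof. by rewrite mulmxA otheta mul1mx. Qed.

Let rootN a : a \in Phi -> - a \in Phi.
Proof.
move=> aPhi; have [_ + _ _] := RPhi => /(_ a aPhi) E.
have : [set a; - a] (- a) by right.
by rewrite -E => -[].
Qed.

(** [- a] is the image of [a] under its own reflection, an element of the Weyl group. *)
Let kN a : a \in Phi -> k (- a) = k a.
Proof.
move=> aPhi; have [_ kW] := mk.
have a2 : dot a a = 2 by have [_ _ _] := RPhi; exact.
have <- : reflection a a = - a.
  by rewrite /reflection a2 scaler_nat mulr2n opprD addrA subrr add0r.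
exact: (kW _ _ (weyl_reflection aPhi (weyl_id Phi)) aPhi).
Qed.

(* Pp' need not be the image of Pp; both contain one root of each pair of
   opposite roots. *)
Lemma positive_subsystem_transport : exists2 eps : 'cV[R]_n -> R,
  (forall a, eps a = 1 \/ eps a = -1) &
  perm_eq Pp' [seq eps a *: (theta *m a) | a <- Pp].
Proof.
have [b bPhi PpE] := posPp; have [b' bPhi' PpE'] := posPp'.
have inP a : a \in Pp -> a \in Phi /\ 0 < dot a b.
  by rewrite PpE !inE /= => /andP[].
(* The sign that makes the image root positive with respect to [b']. *)
pose eps a : R := if 0 < dot (theta *m a) b' then 1 else -1.
have eps2 a : eps a = 1 \/ eps a = -1 by rewrite /eps; case: ifP; [left|right].
exists eps => //; apply: uniq_perm; first exact: fset_uniq.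
  rewrite map_inj_in_uniq ?fset_uniq// => a c /inP[aPhi ab] /inP[cPhi cb] /=.
  have H (u v : 'cV[R]_n) : theta *m u = theta *m v -> u = v.
    by move=> uv; rewrite -(thetaK u) uv thetaK.
  case: (eps2 a) => ->; case: (eps2 c) => ->; rewrite ?scaleN1r ?scale1r.
  - exact: H.
  - rewrite -mulmxN => /H ac; move: ab; rewrite ac dotNl oppr_gt0.
    by move=> /(lt_trans cb); rewrite ltxx.
  - rewrite -mulmxN => /H ac; move: cb; rewrite -ac dotNl oppr_gt0.
    by move=> /(lt_trans ab); rewrite ltxx.
  - by move=> /oppr_inj; exact: H.
have Phi'P z : reflect (exists2 a, a \in Phi & z = theta *m a)
    (z \in [fset theta *m a | a in Phi]%fset).
  by apply: (iffP (imfsetP _ _ _ _)) => -[a aPhi ->]; exists a.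
move=> z; rewrite PpE' !inE /=.
apply/andP/mapP => [[/Phi'P[a aPhi ->] ab']|[a /inP[aPhi ab] ->]].
  have [ab|] := ltrP 0 (dot a b).
    by exists a; [rewrite PpE !inE /= aPhi|rewrite /eps ab' scale1r].
  rewrite le_eqVlt (negbTE (bPhi _ aPhi)) /= => ab.
  exists (- a); first by rewrite PpE !inE /= rootN// dotNl oppr_gt0.
  by rewrite /eps mulmxN dotNl oppr_gt0 ltNge ltW//= scaleN1r opprK.
have aPhi' c : c \in Phi -> theta *m c \in [fset theta *m a | a in Phi]%fset.
  by move=> cPhi; apply/Phi'P; exists c.
have := bPhi' _ (aPhi' _ aPhi); rewrite /eps; case: ltrP => [ab' _|].
  by rewrite scale1r ab' aPhi'.
rewrite le_eqVlt => /orP[/eqP ->|ab' _]; first by rewrite eqxx.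
by rewrite scaleN1r dotNl oppr_gt0 ab' -mulmxN aPhi'// rootN.
Qed.

Let PpPhi a : a \in Pp -> a \in Phi.
Proof. by have [b _ ->] := posPp; rewrite !inE => /andP[]. Qed.

Let k'eps (s : R) a : s = 1 \/ s = -1 -> a \in Pp -> k' (s *: (theta *m a)) = k a.
Proof.
move=> s1 aP; rewrite /k' -scalemxAr thetaK.
by case: s1 => ->; rewrite ?scale1r// scaleN1r kN// PpPhi.
Qed.

Lemma dunkl_weight_transport z :
  dunkl_weight Pp' k' (theta *m z) = dunkl_weight Pp k z.
Proof.
have [eps eps1 P] := positive_subsystem_transport.
rewrite /dunkl_weight (perm_big _ P) /= big_map big_seq [RHS]big_seq.
apply: eq_bigr => a aP; rewrite k'eps// dotZl dot_orthogonal// normrM.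
by case: (eps1 a) => ->; rewrite ?normrN normr1 mul1r.
Qed.

Lemma dunkl_gamma_transport : dunkl_gamma Pp' k' = dunkl_gamma Pp k.
Proof.
have [eps eps1 P] := positive_subsystem_transport.
rewrite /dunkl_gamma (perm_big _ P) /= big_map big_seq [RHS]big_seq.
by apply: eq_bigr => a aP; rewrite k'eps.
Qed.

Let theta_linear : linear (fun x : 'cV[R]_n => theta *m x).
Proof. by move=> t u v; rewrite mulmxDr -scalemxAr. Qed.

Lemma reflection_transport (s : R) a x : s = 1 \/ s = -1 ->
  reflection (s *: (theta *m a)) (theta *m x) = theta *m reflection a x.
Proof.
move=> s1; rewrite /reflection dotZl dot_orthogonal// mulmxBr -scalemxAr scalerA.
by case: s1 => ->; congr (_ - _ *: _); ring.
Qed.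

(** A sign [eps a] enters both [dot a xi] and the difference quotient, so it cancels. On the
    hyperplane the quotient is a derivative, and differentiability lets the sign be pulled out. *)
Lemma dunkl_operator_transport f xi x : (forall z v, derivable f z v) ->
  dunkl_operator Pp' k' (theta *m xi) f (theta *m x) =
  dunkl_operator Pp k xi (f \o (fun z => theta *m z)) x.
Proof.
move=> df; have [eps eps1 P] := positive_subsystem_transport.
rewrite /dunkl_operator (derive_linear f x xi theta_linear); congr (_ + _).
rewrite (perm_big _ P) /= big_map big_seq [RHS]big_seq; apply: eq_bigr => a aP.
rewrite k'eps// dotZl dot_orthogonal// -!mulrA; congr (_ * _).
rewrite mulrCA; congr (_ * _); rewrite /difference_quotient.
rewrite dotZl dot_orthogonal// reflection_transport//.
rewrite (derive_linear f x a theta_linear).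
have s0 : eps a != 0 by case: (eps1 a) => ->; rewrite ?oppr_eq0 oner_eq0.
have s2 : eps a * eps a = 1 by case: (eps1 a) => ->; ring.
rewrite mulf_eq0 (negbTE s0) /=; case: ifPn => ax.
  have [_ ->] := is_derive_dirZ s0 (df (theta *m x) (theta *m a)).
  by rewrite mulrA s2 mul1r.
rewrite invfM mulrCA; congr (_ * _).
by rewrite mulVKf.
Qed.

Lemma dunkl_kernel_transport x y f g :
  is_dunkl_kernel Pp k y g -> is_dunkl_kernel Pp' k' (theta *m y) f ->
  f (theta *m x) = g x.
Proof.
move=> [gA g0 gE] [fA f0 fE].
suff -> : g = f \o (fun z => theta *m z) by [].
have [_ _ _ Phi2] := RPhi; have [k0 _] := mk.
apply: (@dunkl_solution_unique _ _ Pp k y).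
- by move=> a /PpPhi; exact: Phi2.
- by move=> a /PpPhi; exact: k0.
- exact: real_analytic_continuous.
- by move=> z; exact: real_analytic_derivable.
- move=> z; apply: continuous_comp; first exact: mulmx_continuous.
  exact: real_analytic_continuous.
- move=> z; apply: (derivable_linear theta_linear).
  exact: real_analytic_derivable.
- by rewrite /= mulmx0 g0 f0.
- by move=> z; exact: gE.
- move=> z; rewrite -dunkl_operator_transport; last first.
    by move=> *; exact: real_analytic_derivable.
  by rewrite fE dot_orthogonal.
Qed.

Lemma dunkl_constant_transport : dunkl_constant Pp' k' = dunkl_constant Pp k.
Proof.
congr fine.
apply: etrans (esym (integral_cV_orthogonal setT _ otheta)) _.
rewrite preimage_setT; apply: eq_integral => x _.
by rewrite dot_orthogonal// dunkl_weight_transport.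
Qed.

(** Where the weight vanishes both densities are 0. Elsewhere existence is assumed on both sides,
    since the default value on one side only would break the equality. *)
Lemma dunkl_density_transport t y z : 0 < t ->
  (dunkl_weight Pp k z != 0 -> (exists f, is_dunkl_kernel Pp k z f) /\
     (exists f, is_dunkl_kernel Pp' k' (theta *m z) f)) ->
  dunkl_density Pp' k' t (theta *m y) (theta *m z) = dunkl_density Pp k t y z.
Proof.
move=> t0 H; rewrite /dunkl_density dunkl_weight_transport.
have [->|wz] := eqVneq (dunkl_weight Pp k z) 0; first by rewrite !mulr0.
have [[f fK] [g gK]] := H wz.
rewrite dunkl_constant_transport dunkl_gamma_transport !dot_orthogonal//.
congr (_ * _ * _); rewrite !scalemxAr.
have c0 : 0 < (Num.sqrt t)^-1 by rewrite invr_gt0 sqrtr_gt0.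
have fK' := is_dunkl_kernelZ c0 fK; have gK' := is_dunkl_kernelZ c0 gK.
rewrite /dunkl_kernel; apply: dunkl_kernel_transport.
  exact: (xgetPex (fun=> 0) (ex_intro _ _ fK')).
rewrite scalemxAr in gK'.
exact: (xgetPex (fun=> 0) (ex_intro _ _ gK')).
Qed.

End dunkl_transport.

(** * Existence of the Dunkl kernel almost everywhere *)

Section dunkl_kernel_existence.
Context {R : realType} {n : nat}.
Variables (Pp : {fset 'cV[R]_n}) (k : 'cV[R]_n -> R).

Lemma measurable_dunkl_weight : measurable_fun setT (dunkl_weight Pp k).
Proof.
apply: (@measurable_prod _ _ _ _ _ (enum_fset Pp)) => a _.
apply: (measurableT_comp (measurable_powR (2 * k a))).
apply: measurableT_comp => //.
apply: measurable_sum => j; apply: measurable_funM => //.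
exact: measurable_coord.
Qed.

Lemma measurable_gaussian_weight : measurable_fun setT
  (fun z : 'cV[R]_n => expR (- (dot z z / 2)) * dunkl_weight Pp k z).
Proof.
apply: measurable_funM; last exact: measurable_dunkl_weight.
apply: measurableT_comp => //.
apply: measurableT_comp => //.
apply: measurable_funM => //.
by apply: measurable_sum => j; apply: measurable_funM; exact: measurable_coord.
Qed.

Lemma dunkl_weight_ge0 z : 0 <= dunkl_weight Pp k z.
Proof. by apply: prodr_ge0 => a _; exact: powR_ge0. Qed.

(* With the default value 0 of the kernel, p_1(0, z) is the Gaussian weight
   restricted to the z at which a kernel exists. Its mass 1 is that of the full
   Gaussian weight, so a kernel exists for almost all z. *)
Lemma dunkl_kernel_ae_exists :
  (\int[lebesgue_cV n]_z (dunkl_density Pp k 1 0 z)%:E = 1)%E ->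
  exists N, [/\ measurable N, lebesgue_cV n N = 0%E &
    forall z, ~ N z -> dunkl_weight Pp k z != 0 -> exists f, is_dunkl_kernel Pp k z f].
Proof.
set c := dunkl_constant Pp k.
pose F (z : 'cV[R]_n) := expR (- (dot z z / 2)) * dunkl_weight Pp k z.
pose E (z : 'cV[R]_n) : R := (`[< exists f, is_dunkl_kernel Pp k z f >])%:R.
have F0 z : 0 <= F z by rewrite mulr_ge0 ?expR_ge0 ?dunkl_weight_ge0.
have pE z : dunkl_density Pp k 1 0 z = c^-1 * (F z * E z).
  rewrite /dunkl_density scaler0 dunkl_kernel0l sqrtr1 invr1 scale1r powR1 mulr1.
  by rewrite dot0l add0r mulr1 /F /E -/c; ring.
under eq_integral do rewrite pE.
move=> mass1.
(* If [c] were 0, its inverse would be 0 by convention and the density would have mass 0. *)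
have c0 : c != 0.
  apply/eqP => c0; move: mass1; under eq_integral do rewrite c0 invr0 mul0r.
  by rewrite integral0 => -[] /esym/eqP; rewrite oner_eq0.
(* [fine] sends infinite values to 0, so [c != 0] forces the Gaussian integral to be finite. *)
have intF : (\int[lebesgue_cV n]_z (F z)%:E = c%:E)%E.
  rewrite /c /dunkl_constant /Rintegral fineK//.
  move: c0; rewrite /c /dunkl_constant /Rintegral -/(F _).
  rewrite ge0_fin_numE; last by apply: integral_ge0 => z _; rewrite lee_fin; exact: F0.
  by case: (integral _ _ _) => //=; rewrite ?eqxx// => r _; rewrite ltry.
have cpos : 0 < c.
  rewrite lt_def c0 -lee_fin -intF; apply: integral_ge0 => z _.
  by rewrite lee_fin.
have mcF : measurable_fun setT (fun z => c^-1 * F z).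
  by apply: measurable_funM => //; exact: measurable_gaussian_weight.
have intcF : (\int[lebesgue_cV n]_z (c^-1 * F z)%:E = 1)%E.
  under eq_integral do rewrite EFinM.
  rewrite ge0_integralZl//.
  - by rewrite intF -EFinM mulVf.
  - by apply/measurable_EFinP; exact: measurable_gaussian_weight.
  - by move=> z _; rewrite lee_fin.
  - by rewrite lee_fin invr_ge0 ltW.
have [||||N [mN N0 HN]] := @ge0_le_integral_eq _ _ _ (lebesgue_cV n)
    (fun z => c^-1 * F z) (fun z => (c^-1 * (F z * E z))%:E) mcF.
- by move=> z; rewrite lee_fin mulr_ge0 ?invr_ge0 ?(ltW cpos)// mulr_ge0 ?ler0n.
- move=> z; rewrite lee_fin ler_wpM2l ?invr_ge0 ?(ltW cpos)// ler_piMr//.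
  by rewrite /E; case: asboolP; rewrite ?ler01.
- by rewrite mass1 intcF.
- by rewrite intcF ltry.
exists N; split=> // z /HN[+] wz; rewrite /E; case: asboolP => // _ /eqP.
rewrite mulr0 mulr0 eq_sym !mulf_eq0 invr_eq0 (negbTE c0) (negbTE wz) /=.
by rewrite gt_eqF// expR_gt0.
Qed.

End dunkl_kernel_existence.

(** * Transport of the transition kernels *)

Section dunkl_semigroup.
Context {R : realType} {n : nat}.

Lemma dunkl_semigroup_transport (Phi : {fset 'cV[R]_n}) (k : 'cV[R]_n -> R)
    (theta : 'M[R]_n) (Pp Pp' : {fset 'cV[R]_n})
    (Q Q' : R -> R.-pker 'cV[R]_n ~> 'cV[R]_n) :
  root_system Phi -> multiplicity_function Phi k -> orthogonal_mx theta ->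
  positive_subsystem Phi Pp ->
  positive_subsystem [fset theta *m a | a in Phi]%fset Pp' ->
  (forall t y (B : set 'cV[R]_n), 0 < t -> measurable B ->
    Q t y B = (\int[lebesgue_cV n]_(z in B) (dunkl_density Pp k t y z)%:E)%E) ->
  (forall t y (B : set 'cV[R]_n), 0 < t -> measurable B ->
    Q' t y B = (\int[lebesgue_cV n]_(z in B)
      (dunkl_density Pp' (fun a => k (theta^T *m a)) t y z)%:E)%E) ->
  forall t y (B : set 'cV[R]_n), 0 < t -> measurable B ->
    Q' t (theta *m y) B = Q t y ((fun z => theta *m z) @^-1` B).
Proof.
move=> RPhi mk otheta posPp posPp' QE Q'E t y B t0 mB.
have mtheta := measurable_mulmx theta.
have mthetaB := measurable_preimage mtheta mB.
rewrite (Q'E _ _ _ t0 mB) (QE _ _ _ t0 mthetaB).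
have [N1 [mN1 N10 HN1]] := @dunkl_kernel_ae_exists _ _ Pp k
  (etrans (esym (QE 1 0 setT ltr01 measurableT)) (prob_kernel _)).
have [N2 [mN2 N20 HN2]] := @dunkl_kernel_ae_exists _ _ Pp' (fun a => k (theta^T *m a))
  (etrans (esym (Q'E 1 0 setT ltr01 measurableT)) (prob_kernel _)).
apply: etrans (esym (integral_cV_orthogonal B _ otheta)) _.
(* After the change of variables the second density is taken at [theta *m z], so its exceptional set
   is pulled back; it stays null since [theta] preserves Lebesgue measure. *)
pose N := N1 `|` (fun z => theta *m z) @^-1` N2.
apply: (@eq_integral_off_null _ _ _ (lebesgue_cV n) N).
- by apply: measurableU => //; exact: measurable_preimage.
- apply/eqP; rewrite eq_le measure_ge0 andbT.
  apply: le_trans (measureU2 _ _ _) _ => //; first exact: measurable_preimage.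
  have := lebesgue_cV_orthogonal otheta mN2; rewrite N20 => N20'.
  by rewrite [X in (X + _)%E]N10 [X in (_ + X)%E]N20' adde0.
move=> z zN; congr (_%:E).
apply: (dunkl_density_transport RPhi mk otheta posPp posPp' _ t0) => wz; split.
  by apply: HN1 => // zN1; apply: zN; left.
apply: HN2 => [zN2|]; first by apply: zN; right.
by rewrite (dunkl_weight_transport RPhi mk otheta posPp posPp').
Qed.

End dunkl_semigroup.

(** * Laws of Markov processes *)

Section markov_law.
Context {R : realType} {n : nat}.
Implicit Type Q : R -> R.-pker 'cV[R]_n ~> 'cV[R]_n.

Section filtration.
Context d (T : measurableType d) (P : probability T R).
Implicit Types (X : R -> T -> 'cV[R]_n) (s t : R) (A : set T).

Lemma natural_filtration_measurable X s A :
  (forall t, 0 <= t -> measurable_fun setT (X t)) ->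
  natural_filtration X s A -> measurable A.
Proof.
move=> mX; apply: (@smallest_sub _ (sigma_algebra setT) _ measurable).
  exact: sigma_algebra_measurable.
move=> _ [t [B [/andP[t0 _] mB ->]]].
by apply: measurable_preimage => //; exact: mX.
Qed.

Lemma natural_filtration_le X s t A : s <= t ->
  natural_filtration X s A -> natural_filtration X t A.
Proof.
move=> st; apply: sub_smallest2r; first exact: smallest_sigma_algebra.
move=> _ [u [B [/andP[u0 us] mB ->]]].
by exists u, B; rewrite u0 (le_trans us st).
Qed.

Lemma natural_filtration_step X s t A (B : set 'cV[R]_n) : 0 <= s -> s <= t ->
  natural_filtration X s A -> measurable B ->
  natural_filtration X t (A `&` X t @^-1` B).
Proof.
move=> s0 st FA mB.
apply: (@measurableI _ (g_sigma_algebraType [set A | exists s (B : set 'cV[R]_n),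
    [/\ 0 <= s <= t, measurable B & A = X s @^-1` B]]) A).
  exact: natural_filtration_le FA.
apply: sub_sigma_algebra; exists t, B; split => //.
by rewrite lexx (le_trans s0).
Qed.

(** The transition kernel of the image depends on [X] only through [h], and the filtration of [h X]
    is contained in that of [X]. *)
Lemma markov_process_image Q Q' X (h : 'cV[R]_n -> 'cV[R]_n) :
  measurable_fun setT h ->
  (forall t y (B : set 'cV[R]_n), 0 < t -> measurable B -> Q' t (h y) B = Q t y (h @^-1` B)) ->
  markov_process P Q X -> markov_process P Q' (fun t w => h (X t w)).
Proof.
move=> mh QQ' [mX MX]; split=> [t t0|s t A B s0 t0 FA mB].
  by apply: measurableT_comp => //; exact: mX.
have FA' : natural_filtration X s A.
  move: FA; apply: sub_smallest2r; first exact: smallest_sigma_algebra.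
  move=> _ [u [C [u0s mC ->]]].
  by exists u, (h @^-1` C); split => //; exact: measurable_preimage.
rewrite [LHS](MX s t A (h @^-1` B))//; last exact: measurable_preimage.
by apply: eq_integral => w _; rewrite QQ'.
Qed.

End filtration.

(** Expresses the Markov integral through the law of [Z] on the event [A], so that processes on
    different spaces can be compared. *)
Lemma integral_setI_preimage d (T : measurableType d) (P : probability T R)
    (Z : T -> 'cV[R]_n) (A : set T) (mA : measurable A) (mZ : measurable_fun setT Z)
    (phi : 'cV[R]_n -> \bar R) :
  measurable_fun setT phi -> (forall y, 0 <= phi y)%E ->
  (\int[P]_(w in A) phi (Z w) = \int[pushforward (mrestr P mA) Z]_y phi y)%E.
Proof.
move=> mphi phi0; have mphiZ : measurable_fun setT (fun w => phi (Z w)).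
  exact: measurableT_comp.
rewrite (ge0_integral_pushforward mZ (mrestr P mA))// preimage_setT.
rewrite [RHS](@ge0_negligible_integral _ _ _ _ _ (~` A))//.
- rewrite setTD setCK; apply: eq_measure_integral => B mB BA.
  by rewrite /= /mrestr (setIidl BA).
- exact: measurableC.
- by move=> w _; exact: phi0.
- by rewrite /= /mrestr setICl measure0.
Qed.

Section equal_law.
Context d (T : measurableType d) (P : probability T R).
Context d' (T' : measurableType d') (P' : probability T' R).
Variables (Q : R -> R.-pker 'cV[R]_n ~> 'cV[R]_n).
Variables (X : R -> T -> 'cV[R]_n) (Y : R -> T' -> 'cV[R]_n).
Hypothesis MX : markov_process P Q X.
Hypothesis MY : markov_process P' Q Y.

Let agree_at s (A : set T) (A' : set T') :=
  forall B, measurable B -> P (A `&` X s @^-1` B) = P' (A' `&` Y s @^-1` B).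

(** By the Markov property, both sides integrate [Q (t - s)] at [B] intersected with the test set
    against the law of the process at [s] on the past event, and these laws agree. *)
Let agree_step s t A A' B : 0 <= s -> s < t ->
  natural_filtration X s A -> natural_filtration Y s A' -> measurable B ->
  agree_at s A A' -> agree_at t (A `&` X t @^-1` B) (A' `&` Y t @^-1` B).
Proof.
move=> s0 st FA FA' mB AA' C mC; rewrite -!setIA.
rewrite -[X t @^-1` B `&` _]/(X t @^-1` (B `&` C)) -[Y t @^-1` B `&` _]/(Y t @^-1` (B `&` C)).
have [mX MX'] := MX; have [mY MY'] := MY.
have mA := natural_filtration_measurable mX FA.
have mA' := natural_filtration_measurable mY FA'.
have mBC : measurable (B `&` C) by exact: measurableI.
have ts0 : 0 < t - s by rewrite subr_gt0.
have -> : t = s + (t - s) by rewrite addrC subrK.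
rewrite MX'// MY'//.
have mphi := measurable_kernel (Q (t - s)) _ mBC.
rewrite (integral_setI_preimage P mA (mX _ s0) mphi)//.
rewrite (integral_setI_preimage P' mA' (mY _ s0) mphi)//.
apply: eq_measure_integral; [exact: mY|exact: mX|move=> ? ? D mD _].
by rewrite /= /pushforward /mrestr setIC AA'// setIC.
Qed.

(** Induction on the increasing list of times, the constraints already met being absorbed into the
    past events [A] and [A']. *)
Lemma markov_finite_dimensional ts s A A' (B : R -> set 'cV[R]_n) : 0 <= s ->
  natural_filtration X s A -> natural_filtration Y s A' -> agree_at s A A' ->
  (forall t, measurable (B t)) -> path <%R s ts ->
  P (A `&` [set w | forall t, t \in ts -> B t (X t w)]) =
  P' (A' `&` [set w | forall t, t \in ts -> B t (Y t w)]).
Proof.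
elim: ts s A A' => [|t ts IH] s A A' s0 FA FA' AA' mB /=.
  move=> _; have := AA' setT measurableT; rewrite !preimage_setT.
  by congr (P (_ `&` _) = P' (_ `&` _)); apply/seteqP; split.
move=> /andP[st tts].
have := IH t _ _ (le_trans s0 (ltW st))
  (natural_filtration_step s0 (ltW st) FA (mB t))
  (natural_filtration_step s0 (ltW st) FA' (mB t))
  (agree_step s0 st FA FA' (mB t) AA') mB tts.
have E U (Z : R -> U -> 'cV[R]_n) :
    [set w | forall u, u \in t :: ts -> B u (Z u w)] =
    Z t @^-1` B t `&` [set w | forall u, u \in ts -> B u (Z u w)].
  apply/seteqP; split => w /= H; first split.
  - by apply: H; rewrite mem_head.
  - by move=> u uts; apply: H; rewrite in_cons uts orbT.
  - by move=> u; rewrite in_cons => /predU1P[->|]; [case: H|move: u; case: H].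
by rewrite !E !setIA.
Qed.

(** Indexing [B] by time allows one constraint per time, so that intersections merge the constraints
    at common times. *)
Let cylinder_pi : set (set (R -> 'cV[R]_n)) :=
  [set A | exists (ts : seq R) (B : R -> set 'cV[R]_n),
     [/\ forall t, t \in ts -> 0 <= t, forall t, measurable (B t) &
         A = [set g | forall t, t \in ts -> B t (g t)]]].

Let setI_closed_cylinder_pi : setI_closed cylinder_pi.
Proof.
move=> _ _ [ts [B [ts0 mB ->]]] [us [C [us0 mC ->]]].
exists (ts ++ us), (fun t => (if t \in ts then B t else setT) `&`
                           (if t \in us then C t else setT)); split.
- by move=> t; rewrite mem_cat => /orP[/ts0|/us0].
- by move=> t; apply: measurableI; case: ifP.
apply/seteqP; split => g /= H.
  by move=> t _; split; case: ifP => // tin; [exact: H.1|exact: H.2].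
split => t tin; have := H t; rewrite mem_cat tin ?orbT => /(_ isT)[] //.
Qed.

Let cylinder_pi_agree A : (forall B, measurable B -> P (X 0 @^-1` B) = P' (Y 0 @^-1` B)) ->
  cylinder_pi A ->
  [/\ measurable [set w | A (X ^~ w)], measurable [set w | A (Y ^~ w)] &
      P [set w | A (X ^~ w)] = P' [set w | A (Y ^~ w)]].
Proof.
move=> XY0 [ts [B [ts0 mB ->]]].
have meas d0 (U : measurableType d0) (Z : R -> U -> 'cV[R]_n) :
    (forall t, 0 <= t -> measurable_fun setT (Z t)) ->
    measurable [set w | forall t, t \in ts -> B t (Z t w)].
  move=> mZ; have -> : [set w | forall t, t \in ts -> B t (Z t w)] =
      \big[setI/setT]_(t <- ts) (Z t @^-1` B t).
    by rewrite -bigcap_seq.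
  rewrite big_seq; apply: big_ind => // [|t /ts0 t0]; first exact: measurableI.
  by apply: measurable_preimage => //; exact: mZ.
have [mX _] := MX; have [mY _] := MY.
split; [exact: meas|exact: meas|].
(* Time 0 is split off as the initial event, because the induction runs over times strictly after
   the current one. *)
pose B0 : set 'cV[R]_n := if 0 \in ts then B 0 else setT.
have mB0 : measurable B0 by rewrite /B0; case: ifP.
pose us := sort <=%R (undup [seq t <- ts | 0 < t]).
have usP : path <%R 0 us.
  rewrite path_min_sorted.
    by rewrite lt_sorted_uniq_le sort_uniq undup_uniq sort_le_sorted.
  by apply/allP => t; rewrite mem_sort mem_undup mem_filter => /andP[].
have E U (Z : R -> U -> 'cV[R]_n) : [set w | forall t, t \in ts -> B t (Z t w)] =
    Z 0 @^-1` B0 `&` [set w | forall t, t \in us -> B t (Z t w)].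
  apply/seteqP; split => w /= H.
    split; first by rewrite /B0; case: ifP => // /H.
    by move=> t; rewrite mem_sort mem_undup mem_filter => /andP[_ /H].
  move=> t tts; have := ts0 _ tts; rewrite le_eqVlt => /predU1P[t0|t0].
    by have [+ _] := H; rewrite /B0 t0 tts.
  by apply: H.2; rewrite mem_sort mem_undup mem_filter t0.
rewrite !E; apply: (@markov_finite_dimensional us 0) => //.
- by apply: sub_sigma_algebra; exists 0, B0; rewrite lexx.
- by apply: sub_sigma_algebra; exists 0, B0; rewrite lexx.
- by move=> C mC; have := XY0 _ (measurableI _ _ mB0 mC).
Qed.

Lemma markov_equal_in_law :
  (forall B, measurable B -> P (X 0 @^-1` B) = P' (Y 0 @^-1` B)) ->
  equal_in_law P X P' Y.
Proof.
move=> XY0 A cA.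
(* Dynkin's theorem is applied to [H]; measurability is carried along for the complement and union
   steps. *)
pose H : set (set (R -> 'cV[R]_n)) := [set A |
  [/\ measurable [set w | A (X ^~ w)], measurable [set w | A (Y ^~ w)] &
      P [set w | A (X ^~ w)] = P' [set w | A (Y ^~ w)]]].
suff : H A by case.
have : <<s cylinder_pi >> A.
  move: cA; apply: sub_smallest2r; first exact: smallest_sigma_algebra.
  move=> _ [t [B [t0 mB ->]]].
  exists [:: t], (fun=> B); split => //.
    by move=> u; rewrite inE => /eqP ->.
  apply/seteqP; split => g /= gB; first by move=> u; rewrite inE => /eqP ->.
  by apply: gB; rewrite inE.
apply: (@lambda_system_subset _ cylinder_pi setI_closed_cylinder_pi setT H) => //.
  apply/dynkin_lambda_system; split.
  - by rewrite /H /=; split; [exact: measurableT|exact: measurableT|rewrite !probability_setT].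
  - move=> B [mX mY e]; split; [exact: measurableC|exact: measurableC|].
    by rewrite !probability_setC// e.
  move=> F tF HF.
  have mXF i : measurable [set w | F i (X ^~ w)] by have [] := HF i.
  have mYF i : measurable [set w | F i (Y ^~ w)] by have [] := HF i.
  have E U (Z : R -> U -> 'cV[R]_n) : [set w | (\bigcup_i F i) (Z ^~ w)] =
      \bigcup_i [set w | F i (Z ^~ w)] by [].
  have tE U (Z : R -> U -> 'cV[R]_n) : trivIset setT (fun i => [set w | F i (Z ^~ w)]).
    by move=> i j _ _ [w [Fi Fj]]; apply: tF => //; exists (Z ^~ w).
  split; rewrite ?E; [exact: bigcupT_measurable|exact: bigcupT_measurable|].
  rewrite !measure_semi_bigcup//; try exact: bigcupT_measurable.
  by apply: eq_eseriesr => i _; have [] := HF i.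
by move=> B; exact: cylinder_pi_agree.
Qed.

End equal_law.
End markov_law.

(** * Deterministic initial values *)

Section point_mass.
Context {R : realType} {n : nat} d (T : measurableType d) (P : probability T R).

(** A point is a translate of the closed ball of radius 0. *)
Lemma measurable_point_cV (x : 'cV[R]_n) : measurable [set x].
Proof.
have -> : [set x] = (fun y => y + - x) @^-1` [set z : 'cV[R]_n | dot z z <= 0].
  apply/seteqP; split => y /=; first by move=> ->; rewrite subrr dot0l.
  move=> yx; apply/eqP; rewrite -subr_eq0 -dot_eq0.
  by rewrite eq_le yx dot_ge0.
apply: measurable_preimage; last exact: measurable_ball_cV.
exact: measurable_cVD.
Qed.

Lemma point_mass_preimage (Z : T -> 'cV[R]_n) (x : 'cV[R]_n) (B : set 'cV[R]_n) :
  measurable_fun setT Z -> P (Z @^-1` [set x]) = 1%E -> measurable B ->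
  P (Z @^-1` B) = (x \in B)%:R%:E.
Proof.
move=> mZ Px mB.
have mZB : measurable (Z @^-1` B) by exact: measurable_preimage.
have mZx : measurable (Z @^-1` [set x]).
  by apply: measurable_preimage => //; exact: measurable_point_cV.
apply/le_anti/andP; have [/[!inE] xB|/negP/[!inE] xB] := boolP (x \in B).
  rewrite probability_le1//; split => //; rewrite -Px.
  by apply: le_measure; rewrite ?inE// => w /= ->.
rewrite measure_ge0; split => //.
apply: (@le_trans _ _ (P (~` (Z @^-1` [set x])))); last first.
  by rewrite probability_setC// Px subee.
apply: le_measure; rewrite ?inE//; first exact: measurableC.
by move=> w /= wB wx; apply: xB; rewrite -wx.
Qed.

End point_mass.

Theorem proposition5 (R : realType) (n : nat)
    (Phi : {fset 'cV[R]_n}) (k : 'cV[R]_n -> R)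
    (theta : 'M[R]_n) (x : 'cV[R]_n)
    (d : measure_display) (T : measurableType d) (P : probability T R)
    (X : R -> T -> 'cV[R]_n)
    (d' : measure_display) (T' : measurableType d') (P' : probability T' R)
    (Y : R -> T' -> 'cV[R]_n) :
  root_system Phi ->
  multiplicity_function Phi k ->
  orthogonal_mx theta ->
  dunkl_process P k Phi x X ->
  dunkl_process P' (fun a => k (theta^T *m a)) [fset theta *m a | a in Phi]%fset
    (theta *m x) Y ->
  equal_in_law P (fun t w => theta *m X t w) P' Y.
Proof.
move=> RPhi mk otheta [Pp [Q [posPp QE _ MX [_ X0]]]].
move=> [Pp' [Q' [posPp' Q'E _ MY [_ Y0]]]].
have QQ' := dunkl_semigroup_transport RPhi mk otheta posPp posPp' QE Q'E.
have mtheta := measurable_mulmx theta.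
(* It remains to compare the initial laws, which are both the point mass at [theta *m x]. *)
apply: (markov_equal_in_law (markov_process_image mtheta QQ' MX) MY) => B mB.
have [[mX _] [mY _]] := (MX, MY).
rewrite (point_mass_preimage (mY 0 (lexx 0)) Y0 mB).
by rewrite -(point_mass_preimage (mX 0 (lexx 0)) X0 (measurable_preimage mtheta mB)).
Qed.
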